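(* Let $(\mathcal G_n)_{n\ge 0}\sim\mathscr P(1,\pi,\kappa)$ on $[K]$ with $\pi_a>0$ and $\kappa_{a,b}>0$ for all $a,b\in[K]$. (a) For each $a\in[K]$, the empirical degree distribution $\mathbf p_n^a$ of the vertices of type $a$ in $\mathcal G_n$ converges almost surely as $n\to\infty$ to the probability mass function $$\mathbf p^a_\infty(k)=\frac2{\phi_a}\,\frac{\Gamma\big(1+\frac2{\phi_a}\big)\Gamma(k)}{\Gamma\big(k+1+\frac2{\phi_a}\big)},\qquad k\ge1.$$ In particular, $\mathbf p^a_\infty(k)$ is asymptotic to a positive constant times $k^{-(1+2/\phi_a)}$ as $k\to\infty$. (b) As $n\to\infty$, almost surely, for all $a\in[K]$ and all $a'\ne a$ in $[K]$, $$D_{n,a}\to\frac{\mathbf M_{a,a}}{\pi_a},\qquad H_{n,aa'}\to\frac12\Big[\frac{\mathbf M_{a',a}}{\pi_a}+\frac{\mathbf M_{a,a'}}{\pi_{a'}}\Big].$$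
   Context: Model. Fix an integer $K\ge1$, $[K]=\{1,\dots,K\}$, a probability mass function $\pi=(\pi_a)_{a\in[K]}$ and a matrix $\kappa=(\kappa_{a,b})_{a,b\in[K]}$. The random network sequence $(\mathcal G_n)_{n\ge0}\sim\mathscr P(1,\pi,\kappa)$ is built on one probability space as follows. $\mathcal G_0$ is a finite rooted tree whose vertices carry types in $[K]$. Given $\mathcal G_0,\dots,\mathcal G_n$, a new vertex $v_{n+1}$ arrives with $\mathrm{type}(v_{n+1})\sim\pi$, independent of $\mathcal G_0,\dots,\mathcal G_n$, and is attached by a single edge to a vertex of $\mathcal G_n$; given $\mathcal G_n$ and $\mathrm{type}(v_{n+1})=b$, it attaches to $v\in\mathcal G_n$ with probability $$\frac{\kappa_{\mathrm{type}(v),b}\deg(v,n)}{\sum_{v'\in\mathcal G_n}\kappa_{\mathrm{type}(v'),b}\deg(v',n)},$$ where $\deg(v,n)$ is the degree of $v$ in $\mathcal G_n$ (if $\mathcal G_0$ is a single vertex its degree is initialized to be $1$ and increases by one with every edge received). Derived constants. Let $V_\pi(y)=1-\frac12\sum_{j}\pi_j\big(\log y_j+\log\sum_k y_k\kappa_{k,j}\big)$ for $y$ in the interior of the simplex of probability vectors on $[K]$. It is known to have a unique minimizer $\eta=(\eta_1,\dots,\eta_K)$ there. Set $\nu_b=\pi_b/\sum_l\kappa_{l,b}\eta_l$, $\phi_{a,b}=\kappa_{a,b}\nu_b$, $\phi_a=\sum_b\phi_{a,b}$ (one has $\phi_a=2-\pi_a/\eta_a$), and $\mathbf M_{a,b}=\phi_{a,b}/(2-\phi_a)$.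 Homophily statistics. Let $N=|\mathcal G_n|$ be the number of vertices of $\mathcal G_n$, $\mathcal E_n$ its edge set, $\mathcal V_{n,a}$ the set of vertices of type $a$, $\mathcal E_{n,aa'}$ the set of edges between vertices of types $a$ and $a'$ (in either direction), and $p_n=|\mathcal E_n|/\binom N2$. Then $D_{n,a}=|\mathcal E_{n,aa}|/\big(\binom{|\mathcal V_{n,a}|}2p_n\big)$, and for $a\neq a'$, $H_{n,aa'}=|\mathcal E_{n,aa'}|/(|\mathcal V_{n,a}||\mathcal V_{n,a'}|p_n)$. *)

(* Defs.v *)
From HB Require Import structures.
From mathcomp Require Import all_boot all_order all_algebra.
From mathcomp Require Import all_classical all_reals all_analysis.

Set Implicit Arguments.
Unset Strict Implicit.
Unset Printing Implicit Defensive.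

Import Order.TTheory GRing.Theory Num.Theory.
Import numFieldNormedType.Exports.

Local Open Scope classical_set_scope.
Local Open Scope ring_scope.

(* The space [K] of types, K >= 1, is 'I_m.+1 with K = m.+1. *)

(** * Typed networks *)

(* The vertices are the numbers 0, ..., size (ntypes g) - 1, and vertex v has
   type nth ord0 (ntypes g) v.  The undirected edge {u, v} is stored once, as
   the pair (u, v) with u < v. *)
Record network (m : nat) := Network {
  ntypes : seq 'I_m.+1;
  nedges : seq (nat * nat)
}.

Section Network.
Variable m : nat.
Implicit Types (g : network m) (a b : 'I_m.+1) (u v k : nat).

Definition gorder g : nat := size (ntypes g).
Definition vertices g : seq nat := iota 0 (gorder g).
Definition vtype g v : 'I_m.+1 := nth ord0 (ntypes g) v.

Definition adj g : rel 'I_(gorder g) := fun u v : 'I_(gorder g) =>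
  ((u : nat, v : nat) \in nedges g) || ((v : nat, u : nat) \in nedges g).

Definition simple_network g : bool :=
  uniq (nedges g) && all (fun e => e.1 < e.2 < gorder g)%N (nedges g).

(* A finite typed tree.  Vertices may be numbered at will, so the root may be
   taken to be vertex 0. *)
Definition is_tree g : Prop :=
  [/\ (0 < gorder g)%N,
      simple_network g,
      (forall u v : 'I_(gorder g), connect (adj (g := g)) u v) &
      (forall c : seq 'I_(gorder g), (2 < size c)%N ->
         ~ ucycle (adj (g := g)) c)].

(* The new vertex gets the next number, gorder g. *)
Definition attach g v b : network m :=
  Network (rcons (ntypes g) b) (rcons (nedges g) (v, gorder g)).

(* Degree of v in a network g grown from g0: if g0 is a single vertex, the
   degree of that vertex starts at 1 instead of 0. *)
Definition deg (g0 g : network m) v : nat :=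
  (count (fun e => (e.1 == v) || (e.2 == v)) (nedges g)
   + ((gorder g0 == 1) && (v == 0)))%N.

Definition nvert g a : nat := count_mem a (ntypes g).

Definition nedge g a a' : nat :=
  count (fun e => ((vtype g e.1 == a) && (vtype g e.2 == a'))
               || ((vtype g e.1 == a') && (vtype g e.2 == a))) (nedges g).

Variable R : realType.

Definition edge_density g : R := (size (nedges g))%:R / 'C(gorder g, 2)%:R.

Definition homD g a : R :=
  (nedge g a a)%:R / ('C(nvert g a, 2)%:R * edge_density g).

Definition homH g a a' : R :=
  (nedge g a a')%:R / ((nvert g a)%:R * (nvert g a')%:R * edge_density g).

(* p_n^a(k): proportion of vertices of degree k among those of type a. *)
Definition emp_deg (g0 g : network m) a k : R :=
  (count (fun v => (vtype g v == a) && (deg g0 g v == k)) (vertices g))%:R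
  / (nvert g a)%:R.

End Network.

(** * The random network sequence *)

Section Model.
Context {d : measure_display} {T : measurableType d} {R : realType}.
Variables (m : nat) (P : probability T R).
Variables (pi : 'I_m.+1 -> R) (kappa : 'M[R]_m.+1).
Variable g0 : network m.

Definition attach_prob (g : network m) (b : 'I_m.+1) (v : nat) : R :=
  kappa (vtype g v) b * (deg g0 g v)%:R
  / \sum_(u <- vertices g) kappa (vtype g u) b * (deg g0 g u)%:R.

(* tau n is the type of v_(n+1), and alpha n the vertex of G_n to which
   v_(n+1) is attached. *)
Variables (tau : nat -> T -> 'I_m.+1) (alpha : nat -> T -> nat).

Fixpoint net (n : nat) (w : T) : network m :=
  if n is n'.+1 then attach (net n' w) (alpha n' w) (tau n' w) else g0.

(* The event {G_0 = h 0, ..., G_n = h n}; only h 0, ..., h n matter. *)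
Definition history (n : nat) (h : nat -> network m) : set T :=
  [set w | forall i, (i <= n)%N -> net i w = h i].

(* The sequence (net n)_n has law P(1, pi, kappa) started from g0.  The
   conditional laws are given on the atoms history n h of the sigma-algebra of
   (G_0, ..., G_n), which is generated by countably many atoms, and in product
   form, so that nothing is divided by the probability of a null event. *)
Record is_network_process : Prop := IsNetworkProcess {
  np_measurable_tau : forall n b, measurable [set w | tau n w = b];
  np_measurable_alpha : forall n v, measurable [set w | alpha n w = v];
  np_alpha_vertex : forall n w, (alpha n w < gorder (net n w))%N;
  np_tau_law : forall n b, P [set w | tau n w = b] = (pi b)%:E;
  np_tau_indep : forall n h b,
    P (history n h `&` [set w | tau n w = b])
    = (P (history n h) * P [set w | tau n w = b])%E;
  np_alpha_law : forall n h b v, (v < gorder (h n))%N ->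
    P (history n h `&` [set w | tau n w = b] `&` [set w | alpha n w = v])
    = (P (history n h `&` [set w | tau n w = b])
       * (attach_prob (h n) b v)%:E)%E
}.

End Model.

(** * Derived constants *)

Section Constants.
Variables (R : realType) (m : nat).
Variables (pi : 'I_m.+1 -> R) (kappa : 'M[R]_m.+1).

Definition is_pmf_on_types : Prop :=
  (forall a, 0 <= pi a) /\ \sum_a pi a = 1.

Definition in_open_simplex (y : 'I_m.+1 -> R) : Prop :=
  (forall a, 0 < y a) /\ \sum_a y a = 1.

Definition V_pi (y : 'I_m.+1 -> R) : R :=
  1 - 2^-1 * \sum_j pi j * (ln (y j) + ln (\sum_k y k * kappa k j)).

Definition is_minimizer (eta : 'I_m.+1 -> R) : Prop :=
  in_open_simplex eta /\
  forall y, in_open_simplex y -> V_pi eta <= V_pi y.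

Variable eta : 'I_m.+1 -> R.

Definition nu (b : 'I_m.+1) : R := pi b / \sum_l kappa l b * eta l.
Definition phi2 (a b : 'I_m.+1) : R := kappa a b * nu b.
Definition phi (a : 'I_m.+1) : R := \sum_b phi2 a b.
Definition Mmx : 'M[R]_m.+1 := \matrix_(a, b) (phi2 a b / (2 - phi a)).

(* Euler's Gamma function, meaningful for x > 0. *)
Definition Gamma (x : R) : R :=
  Rintegral lebesgue_measure `]0, +oo[%classic
    (fun t : R => t `^ (x - 1) * expR (- t)).

(* The limiting mass function on k >= 1, extended by 0 to k = 0. *)
Definition p_inf (a : 'I_m.+1) (k : nat) : R :=
  if k is 0%N then 0 else
  2 / phi a * (Gamma (1 + 2 / phi a) * Gamma k%:R
               / Gamma (k%:R + 1 + 2 / phi a)).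

End Constants.

(* Probability mass functions on the natural numbers. *)
Definition is_pmf (R : realType) (p : nat -> R) : Prop :=
  (forall k, 0 <= p k) /\ series p @ \oo --> (1 : R).

(* Main.v *)
Require Import Defs.
From HB Require Import structures.
From mathcomp Require Import all_boot all_order all_algebra.
From mathcomp Require Import all_classical all_reals all_analysis.
From mathcomp Require Import measurable_realfun ring lra.

(* Every statistic [f] of the network with bounded increments satisfies a
   strong law: [f (G_n)] minus the accumulated conditional drifts is [o(n)]
   almost surely (second moments, Chebyshev and Borel-Cantelli along [n = k ^ 4],
   all conditional expectations being finite sums over attachment histories).
   Outside a null set the rest is deterministic.
   The share [x a] of the total degree carried by type [a] has drift
   [pi a + x a * phi a (x) - 2 * x a] with
   [phi a (x) = sum_b kappa a b * pi b / sum_l kappa l b * x l].  Replacing [x]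
   by its compensator turns the noise into a vanishing perturbation of the
   drift, and the relative entropy of [eta] with respect to the share is then a
   Lyapunov function: by the first-order condition [pi a / eta a + phi a = 2]
   its dissipation dominates a chi-square distance to [eta], hence the relative
   entropy itself.  So the shares converge to [eta].
   Once this is known, the drifts of the degree counts and of the edge counts
   are asymptotically affine, which gives their limits; the limiting degree
   counts satisfy the recursion of the Yule-Simon law with parameter
   [2 / phi a], solved by quotients of Gamma functions. *)

Set Implicit Arguments.
Unset Strict Implicit.
Unset Printing Implicit Defensive.

Import Order.TTheory GRing.Theory Num.Theory.
Import numFieldNormedType.Exports.

Local Open Scope classical_set_scope.
Local Open Scope ring_scope.

(** * Averaging recursions *)

(** The laws of the process are given on atoms of the history, so the second moment of a compensated
    statistic is bounded by splitting atoms, without conditioning on null events. The total degree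
    is deterministic, [s0 + 2 n], so shares are degrees divided by a known affine sequence. The
    growth [2] per step meets the [2] of the first-order condition, and [n] times the chance that a
    given unit of degree of type [a] is chosen tends to [phi a / 2], whence the parameter
    [2 / phi a]. The obstacle is the boundary of the simplex: the relative entropy is singular
    there, and the random share may start there. The compensator of the degree of type [a] grows by
    at least [pi a] at each step, so from time [1] on its share is bounded below by explicit
    constants, the second-order remainder of the entropy is [O(1 / n ^ 2)], and the noise never
    enters a logarithm, only the bounded continuous field [flow]. *)

Section StochasticApproximation.
Variable R : realType.
Implicit Types (u e b c D F : nat -> R).

Lemma cvg_series_harmonic_pinfty : series (@harmonic R) @ \oo --> +oo.
Proof.
apply: nondecreasing_dvgn_lt; last exact: dvg_harmonic.
apply/nondecreasing_seqP => n.
by rewrite seriesEnat /= big_nat_recr //= lerDl harmonic_ge0.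
Qed.

(** Once [e n <= c0 * (d / 2)], the excess of [u] over [d / 2] is multiplied at each step by at most
    [1 - c0 / (n + 1) <= expR (- c0 / (n + 1))], and the harmonic series diverges. *)
Lemma robbins_monro_cvg0 (c0 : R) u e : 0 < c0 ->
  (\forall n \near \oo, 0 <= u n) ->
  (\forall n \near \oo,
     u n.+1 <= (1 - c0 / n.+1%:R) * u n + e n / n.+1%:R) ->
  e n @[n --> \oo] --> 0 -> u n @[n --> \oo] --> 0.
Proof.
move=> c_gt0 [N0 _ u_ge0] [N1 _ u_step] e0.
apply/cvgr0Pnorm_le => /= d d_gt0.
have d2_gt0 : 0 < d / 2 by rewrite divr_gt0.
have /cvgr0Pnorm_le/(_ (c0 * (d / 2)) (mulr_gt0 c_gt0 d2_gt0))[N2 _ e_le] := e0.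
have [N3 _ c_le] := nbhs_infty_ger c0.
pose N := maxn (maxn N0 N1) (maxn N2 N3).
pose H := series (@harmonic R).
have HS n : H n.+1 = H n + n.+1%:R^-1.
  by rewrite /H seriesEnat /= big_nat_recr.
(* The absolute value keeps the bound nonnegative when the initial excess is negative, so that the
   contraction factor may be replaced by the larger exponential. *)
have bnd j : u (N + j)%N - d / 2 <=
    `|u N - d / 2| * expR (- c0 * (H (N + j)%N - H N)).
  elim: j => [|j IHj].
    by rewrite addn0 subrr mulr0 expR0 mulr1 ler_norm.
  rewrite addnS; set n := (N + j)%N in IHj *.
  have nN : (N <= n)%N by rewrite leq_addr.
  have [n1 n2 n3] : [/\ N1 <= n, N2 <= n & N3 <= n]%N.
    by move: nN; rewrite /N !geq_max; case/andP => /andP[_ ->] /andP[-> ->].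
  have := u_step n n1.
  have := e_le n n2; rewrite /= => /ler_normlW en.
  have cn : c0 <= n.+1%:R.
    by apply: le_trans (c_le n n3) _; rewrite /= ler_nat.
  have n0 : (0 : R) < n.+1%:R by rewrite ltr0n.
  have q_ge0 : 0 <= 1 - c0 / n.+1%:R by rewrite subr_ge0 ler_pdivrMr // mul1r.
  move=> /le_trans us.
  have {us} : u n.+1 - d / 2 <= (1 - c0 / n.+1%:R) * (u n - d / 2).
    rewrite lerBlDr; apply: us.
    have : e n / n.+1%:R <= c0 * (d / 2) / n.+1%:R by rewrite ler_pM2r ?invr_gt0.
    set x := n.+1%:R^-1; lra.
  move=> /le_trans; apply.
  apply: le_trans (ler_wpM2l q_ge0 IHj) _.
  rewrite HS.
  have -> : - c0 * (H n + n.+1%:R^-1 - H N) =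
    - c0 * (H n - H N) + (- (c0 / n.+1%:R)) by ring.
  rewrite expRD [leRHS]mulrA [leRHS]mulrC ler_wpM2r //.
  exact: expR_ge1Dx.
have lim0 : `|u N - d / 2| * expR (- (c0 * (H n - H N))) @[n --> \oo] --> 0.
  rewrite -[X in _ --> X](mulr0 `|u N - d / 2|).
  apply: cvgM; first exact: cvg_cst.
  have cv : c0 * (H n - H N) @[n --> \oo] --> +oo.
    apply/cvgryPge => A; near=> n.
    rewrite mulrC -ler_pdivrMr // lerBrDr; near: n.
    exact: (cvgryPge _).1 cvg_series_harmonic_pinfty _.
  by have := cvg_comp _ _ cv (@cvgr_expR R).
have /cvgr0Pnorm_le/(_ _ d2_gt0)[N4 _ small] := lim0.
exists (maxn N N4) => // n /=; rewrite geq_max => /andP[nN nN4].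
have u0 : 0 <= u n by apply: u_ge0; apply: leq_trans nN; rewrite /N !leq_max leqnn.
rewrite ger0_norm //.
have := bnd (n - N)%N; rewrite subnKC // mulNr.
have := small n nN4; rewrite /= => /ler_normlW; lra.
Unshelve. all: by end_near. Qed.

(* With [U n] the sum of the drifts, [F n / n] and [U n / n] have the same
   limit, and [U n / n - beta / (1 + gamma)] satisfies the recursion of
   [robbins_monro_cvg0] with contraction rate [(1 + gamma) / (n + 1)]. *)
Lemma cvg_drift_average F D b c (beta gamma K : R) :
  0 <= gamma ->
  (\forall n \near \oo, D n = b n - c n * (F n / n%:R)) ->
  (\forall n \near \oo, `|F n / n%:R| <= K) ->
  b n @[n --> \oo] --> beta -> c n @[n --> \oo] --> gamma ->
  (F n - \sum_(i < n) D i) / n%:R @[n --> \oo] --> 0 ->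
  F n / n%:R @[n --> \oo] --> beta / (1 + gamma).
Proof.
move=> gamma_ge0 D_eq F_bnd cb cc cM.
set l := beta / (1 + gamma).
pose U n := \sum_(i < n) D i.
(* The error made by replacing [b] and [c] by their limits and [F n / n] by [U n / n]. *)
pose e n := (b n - beta) - (c n - gamma) * (F n / n%:R)
            - gamma * ((F n - U n) / n%:R).
have cK : (c n - gamma) * (F n / n%:R) @[n --> \oo] --> 0.
  apply: norm_cvg0.
  apply: (@squeeze_cvgr _ _ _ _ (fun=> 0) (fun n => `|c n - gamma| * K)).
  - near=> n; rewrite normr_ge0 /= normrM ler_wpM2l //.
    by near: n; exact: F_bnd.
  - exact: cvg_cst.
  - rewrite -[X in _ --> X](mul0r K).
    apply: cvgM; last exact: cvg_cst.
    by rewrite -(normr0 R) -(subrr gamma); apply: cvg_norm; apply: cvgB => //; exact: cvg_cst.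
have e0 : e n @[n --> \oo] --> 0.
  have -> : 0 = (beta - beta) - 0 - gamma * 0 :> R by ring.
  apply: cvgB; first apply: cvgB => //.
    by apply: cvgB => //; exact: cvg_cst.
  by apply: cvgM => //; exact: cvg_cst.
pose v n := U n / n%:R - l.
have v0 : `|v n| @[n --> \oo] --> 0.
  apply: (@robbins_monro_cvg0 (1 + gamma) _ (fun n => `|e n|)).
  - lra.
  - by near=> n; exact: normr_ge0.
  - near=> n.
    have n_gt0 : (0 : R) < n%:R by rewrite ltr0n; near: n; exact: nbhs_infty_gt.
    have n1_gt0 : (0 : R) < n.+1%:R by rewrite ltr0n.
    have gn : gamma <= n%:R by near: n; exact: nbhs_infty_ger.
    have Dn : D n = b n - c n * (F n / n%:R) by near: n.
    (* The [1] in the rate [1 + gamma] comes from renormalising [U n.+1 = U n + D n] by [n.+1]; the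
       constants cancel because [beta = l * (1 + gamma)]. *)
    have -> : v n.+1 = (1 - (1 + gamma) / n.+1%:R) * v n + e n / n.+1%:R.
      have hl : l * (1 + gamma) = beta by rewrite /l divfK //; lra.
      rewrite /v /e /U big_ord_recr /= Dn -/(U n) -hl -(natr1 n).
      field; rewrite natr1 !lt0r_neq0 //.
    apply: le_trans (ler_normD _ _) _.
    rewrite !normrM [`|n.+1%:R^-1|]gtr0_norm ?invr_gt0 //.
    rewrite [`|1 - _|]ger0_norm // subr_ge0 ler_pdivrMr // mul1r -natr1; lra.
  - by rewrite -(normr0 R); apply: cvg_norm.
have {}v0 : v n @[n --> \oo] --> 0 by exact: norm_cvg0.
have -> : (fun n => F n / n%:R) = (fun n => (F n - U n) / n%:R + (v n + l)).
  by apply/funext => n; rewrite /v subrK mulrBl subrK.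
rewrite -[X in _ --> X]add0r; apply: cvgD => //.
by rewrite -[X in _ --> X]add0r; apply: cvgD => //; exact: cvg_cst.
Unshelve. all: by end_near. Qed.

End StochasticApproximation.

(** * The Gamma function *)

Section Gamma.
Variable R : realType.
Implicit Types (x t p b : R).
Notation mu := (@lebesgue_measure R).

Definition gamma_integrand (x t : R) : R := t `^ (x - 1) * expR (- t).

(** Extended-real valued, so that finiteness is proved before passing to [Gamma]; the added endpoint
    [0] is a null set. *)
Definition gamma_integral (x : R) : \bar R :=
  \int[mu]_(t in `[0, +oo[) (gamma_integrand x t)%:E.

Lemma gamma_integrand_ge0 x t : 0 <= gamma_integrand x t.
Proof. by rewrite mulr_ge0 ?powR_ge0 ?expR_ge0. Qed.

Lemma continuous_expRN : continuous (fun t : R => expR (- t)).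
Proof.
move=> t; apply: continuous_comp; last exact: continuous_expR.
exact: opp_continuous.
Qed.

Lemma measurable_gamma_integrand x :
  measurable_fun [set: R] (gamma_integrand x).
Proof.
apply: measurable_funM; first exact: measurable_powR.
exact: continuous_measurable_fun continuous_expRN.
Qed.

Lemma GammaE x : Gamma x = fine (gamma_integral x).
Proof.
rewrite /Gamma /Rintegral /gamma_integral integral_itv_obnd_cbnd //.
apply/measurable_EFinP; apply: measurable_funTS.
exact: measurable_gamma_integrand.
Qed.

Lemma is_derive_expRN t : is_derive t 1 (fun s : R => - expR (- s)) (expR (- t)).
Proof.
rewrite -[X in is_derive _ _ _ X]opprK -[X in - X]mulrN1.
by apply: is_deriveN; apply: is_derive1_comp.
Qed.

Lemma integral_expRN (a : R) :
  (\int[mu]_(t in `[a, +oo[) (expR (- t))%:E = (expR (- a))%:E)%E.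
Proof.
rewrite (@ge0_continuous_FTC2y _ _ (fun t => - expR (- t)) _ 0).
- by rewrite -EFinB sub0r opprK.
- by move=> *; exact: expR_ge0.
- exact: continuous_subspaceT continuous_expRN.
- by rewrite -oppr0; apply: cvgN; exact: cvgr_expR.
- by move=> t _; have [] := is_derive_expRN t.
- by apply: cvgN; apply: cvg_at_right_filter; exact: continuous_expRN.
- move=> t _; rewrite derive1E; by have [_ ->] := is_derive_expRN t.
Qed.

Lemma gamma_integral1 : gamma_integral 1 = 1%E.
Proof.
transitivity (\int[mu]_(t in `[0%R, +oo[) (expR (- t))%:E)%E; last first.
  by rewrite integral_expRN oppr0 expR0.
by apply: eq_integral => t _; rewrite /gamma_integrand subrr powRr0 mul1r.
Qed.

Lemma cvg_powR_at_right0 p : 0 <= p -> t `^ p @[t --> 0^'+] --> (0 : R) `^ p.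
Proof.
rewrite le_eqVlt => /predU1P[<-|p_gt0].
  rewrite powRr0; under eq_fun do rewrite powRr0; exact: cvg_cst.
by rewrite powR0 ?gt_eqF //; exact: powR_cvg0.
Qed.

Lemma derivable_oo_powR p b : 0 < b -> 0 <= p ->
  derivable_oo_LRcontinuous (fun t : R => t `^ p) 0 b.
Proof.
move=> b_gt0 p_ge0; split.
- move=> t; rewrite in_itv /= => /andP[t_gt0 _].
  by apply: derivable_powR; rewrite in_itv /= t_gt0.
- exact: cvg_powR_at_right0.
- apply: cvg_at_left_filter.
  apply: (@differentiable_continuous R R^o R^o _ (fun t : R^o => t `^ p)).
  by apply/derivable1_diffP/derivable_powR; rewrite in_itv /= b_gt0.
Qed.

(** For an integer [k >= x], a single term of the exponential series bounds the sequence by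
    [(k + 1)! / n]. *)
Lemma powR_expRN_cvg0 x : n%:R `^ x * expR (- n%:R) @[n --> \oo] --> (0 : R).
Proof.
have [k _ xk] := nbhs_infty_ger x.
apply: (@squeeze_cvgr _ _ _ _ (fun=> 0) (fun n : nat => k.+1`!%:R * n%:R^-1)).
- near=> n.
  have n_gt0 : (0 : R) < n%:R by rewrite ltr0n; near: n; exact: nbhs_infty_gt.
  rewrite mulr_ge0 ?powR_ge0 ?expR_ge0 //= expRN.
  have h1 : n%:R `^ x <= n%:R ^+ k :> R.
    rewrite -powR_mulrn ?ler0n // ler_powR ?ler1n -?(ltr0n R) //.
    exact: (xk k (leqnn k)).
  have h2 : n%:R ^+ k.+1 / k.+1`!%:R <= expR n%:R :> R.
    apply: le_trans (expR_ge1Dxn k (ler0n _ n)); lra.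
  rewrite ler_pdivrMr ?expR_gt0 // (le_trans h1) //.
  have f_gt0 : (0 : R) < k.+1`!%:R by rewrite ltr0n fact_gt0.
  have -> : n%:R ^+ k = k.+1`!%:R / n%:R * (n%:R ^+ k.+1 / k.+1`!%:R) :> R.
    by rewrite exprS; field; rewrite !lt0r_neq0.
  by rewrite ler_wpM2l // divr_ge0 // ltW.
- exact: cvg_cst.
- rewrite -[X in _ --> X](mulr0 k.+1`!%:R); apply: cvgM; first exact: cvg_cst.
  apply/gtr0_cvgV0; last exact: cvgr_idn.
  by near=> n; rewrite ltr0n; near: n; exact: nbhs_infty_gt.
Unshelve. all: by end_near. Qed.

(** The assumption [1 <= x] makes [t ^ (x - 1)] continuous at [0], so integration by parts applies
    on the closed segment. Every argument of Gamma in [p_inf] at [k >= 1] is at least [1]. *)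
Lemma gamma_integral_by_parts x (n : nat) : 1 <= x -> (0 < n)%N ->
  (\int[mu]_(t in `[0%R, n%:R]) (gamma_integrand (x + 1) t)%:E =
   (- (n%:R `^ x * expR (- n%:R)))%:E
   + x%:E * \int[mu]_(t in `[0%R, n%:R]) (gamma_integrand x t)%:E)%E.
Proof.
move=> x_ge1 n_gt0.
have x_gt0 : 0 < x by lra.
have N_gt0 : (0 : R) < n%:R by rewrite ltr0n.
have cp : {within `[0, n%:R], continuous (fun t => t `^ (x - 1))}.
  apply: derivable_oo_LRcontinuous_within.
  by apply: derivable_oo_powR => //; rewrite subr_ge0.
have cE : {within `[0, n%:R], continuous (fun t : R => expR (- t))}.
  exact: continuous_subspaceT continuous_expRN.
have ig : mu.-integrable `[0, n%:R] (EFin \o gamma_integrand x).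
  apply: continuous_compact_integrable; first exact: segment_compact.
  apply/subspace_continuousP => t ht; apply: cvgM.
    by move/subspace_continuousP : cp; exact.
  by move/subspace_continuousP : cE; exact.
transitivity (\int[mu]_(t in `[0%R, n%:R]) (t `^ x * expR (- t))%:E)%E.
  by apply: eq_integral => t _; rewrite /gamma_integrand addrK.
rewrite (@integration_by_parts _ (fun t => t `^ x) (fun t => - expR (- t))
  (fun t => x * t `^ (x - 1)) (fun t => expR (- t))) //.
- rewrite powR0 ?gt_eqF // mul0r subr0 mulrN; congr (_ + _)%E.
  transitivity (- \int[mu]_(t in `[0%R, n%:R])
      ((- x)%:E * (gamma_integrand x t)%:E))%E.
    congr (- _)%E; apply: eq_integral => t _.
    by rewrite -EFinM /gamma_integrand; congr EFin; ring.
  by rewrite integralZl // EFinN mulNe oppeK.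
- apply/subspace_continuousP => t ht; apply: cvgM; first exact: cvg_cst.
  by move/subspace_continuousP : cp; exact.
- by apply: derivable_oo_powR => //; exact: ltW.
- by move=> t /[!in_itv] /= /andP[t_gt0 _]; rewrite powR_derive1 ?in_itv /= ?t_gt0.
- split.
  + by move=> t _; have [] := is_derive_expRN t.
  + by apply: cvgN; apply: cvg_at_right_filter; exact: continuous_expRN.
  + by apply: cvgN; apply: cvg_at_left_filter; exact: continuous_expRN.
- by move=> t _; rewrite derive1E; have [_ ->] := is_derive_expRN t.
Qed.

(** Obtained in the extended reals as a limit of integrals over [[0, n]]; finiteness at the integers
    is then an induction on this recursion. *)
Lemma gamma_integralS x : 1 <= x ->
  gamma_integral (x + 1) = (x%:E * gamma_integral x)%E.
Proof.
move=> x_ge1.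
have cvgI y : (\int[mu]_(t in `[0%R, n%:R]) (gamma_integrand y t)%:E)%E
    @[n --> \oo] --> gamma_integral y.
  apply: ge0_cvgn_integral; first exact: gamma_integrand_ge0.
  exact: measurable_gamma_integrand.
have lim1 := cvgI (x + 1).
have lim2 : (\int[mu]_(t in `[0%R, n%:R]) (gamma_integrand (x + 1) t)%:E)%E
    @[n --> \oo] --> (0%:E + x%:E * gamma_integral x)%E.
  apply: (@cvg_trans _ (((- (n%:R `^ x * expR (- n%:R)))%:E
     + x%:E * \int[mu]_(t in `[0%R, n%:R]) (gamma_integrand x t)%:E)%E
     @[n --> \oo])).
    apply: near_eq_cvg; near=> n.
    rewrite gamma_integral_by_parts //; near: n; exact: nbhs_infty_gt.
  apply: cvgeD; first by rewrite fin_num_adde_defr.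
    apply: cvg_EFin; first exact: nearW.
    by rewrite -oppr0; apply: cvgN; exact: powR_expRN_cvg0.
  by apply: cvgeZl => //; exact: cvgI.
rewrite -[RHS]add0e; exact: (cvg_unique (@ereal_hausdorff R) lim1 lim2).
Unshelve. all: by end_near. Qed.

Lemma gamma_integral_nat_fin (n : nat) : gamma_integral n.+1%:R \is a fin_num.
Proof.
elim: n => [|n IHn]; first by rewrite gamma_integral1.
by rewrite -natr1 gamma_integralS ?ler1n // fin_numM.
Qed.

(** Comparison with the integer arguments [1] and [n + 1]: [t ^ (x - 1) <= 1 + t ^ n] when
    [x - 1 <= n]. *)
Lemma gamma_integral_fin x : 1 <= x -> gamma_integral x \is a fin_num.
Proof.
move=> x_ge1; have [n _ xn] := nbhs_infty_ger (x - 1).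
have {xn}xn : x - 1 <= n%:R by exact: (xn n (leqnn n)).
rewrite ge0_fin_numE; last by apply: integral_ge0 => t _; rewrite lee_fin gamma_integrand_ge0.
apply: (@le_lt_trans _ _ (gamma_integral 1 + gamma_integral n.+1%:R)%E); last first.
  by rewrite ltey_eq fin_numD gamma_integral1 gamma_integral_nat_fin.
have mg (y : R) : measurable_fun [set: R] (EFin \o gamma_integrand y).
  by apply/measurable_EFinP; exact: measurable_gamma_integrand.
rewrite /gamma_integral -ge0_integralD //; do ?
  [by move=> t _; rewrite lee_fin gamma_integrand_ge0
  |by apply: measurable_funTS; exact: mg].
apply: ge0_le_integral => //; do ?
  [by move=> t _; rewrite lee_fin gamma_integrand_ge0
  |by apply: measurable_funTS; exact: mg
  |by apply: measurable_funTS; apply: emeasurable_funD; exact: mg].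
move=> t; rewrite /= in_itv /= andbT => t_ge0.
rewrite -EFinD lee_fin /gamma_integrand -mulrDl ler_wpM2r ?expR_ge0 //.
rewrite subrr powRr0 -natr1 addrK powR_mulrn //.
have [t1|t1] := leP t 1.
  have : t `^ (x - 1) <= 1 `^ (x - 1).
    by apply: ge0_ler_powR; rewrite ?nnegrE ?subr_ge0.
  rewrite powR1 => /le_trans; apply; rewrite lerDl; exact: exprn_ge0.
rewrite -powR_mulrn //; apply: (@le_trans _ _ (t `^ n%:R)); last by rewrite lerDr.
by rewrite ler_powR // ltW.
Qed.

Lemma Gamma1 : Gamma 1 = 1 :> R.
Proof. by rewrite GammaE gamma_integral1. Qed.

Lemma GammaS x : 1 <= x -> Gamma (x + 1) = x * Gamma x.
Proof.
move=> x_ge1; rewrite !GammaE gamma_integralS // fineM //.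
exact: gamma_integral_fin.
Qed.

(** On [[1, +oo[] the integrand dominates [expR (- t)], whose integral there is [expR (- 1)]. *)
Lemma Gamma_gt0 x : 1 <= x -> 0 < Gamma x.
Proof.
move=> x_ge1; rewrite GammaE fine_gt0 //.
rewrite -ge0_fin_numE; last by apply: integral_ge0 => t _; rewrite lee_fin gamma_integrand_ge0.
rewrite gamma_integral_fin // andbT.
apply: (@lt_le_trans _ _ (expR (- 1))%:E); first by rewrite lte_fin expR_gt0.
rewrite -integral_expRN.
have mg : measurable_fun [set: R] (EFin \o gamma_integrand x).
  by apply/measurable_EFinP; exact: measurable_gamma_integrand.
have me : measurable_fun [set: R] (EFin \o (fun t => expR (- t))).
  by apply/measurable_EFinP; exact: continuous_measurable_fun continuous_expRN.
apply: (@le_trans _ _ (\int[mu]_(t in `[1%R, +oo[) (gamma_integrand x t)%:E)%E).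
  apply: ge0_le_integral => //; do ?
    [by move=> t _; rewrite lee_fin expR_ge0
    |by apply: measurable_funTS; exact: me
    |by apply: measurable_funTS; exact: mg].
  move=> t; rewrite /= in_itv /= andbT => t_ge1.
  rewrite lee_fin /gamma_integrand ler_peMl ?expR_ge0 //.
  have x1 : 0 <= x - 1 by rewrite subr_ge0.
  by have := ler_powR t_ge1 x1; rewrite powRr0.
apply: ge0_subset_integral => //; do ?
  [by move=> t _; rewrite lee_fin gamma_integrand_ge0
  |by apply: measurable_funTS; exact: mg].
by apply: subset_itvr; rewrite bnd_simp.
Qed.

End Gamma.

(** * The Yule-Simon law *)

(** The upper bound [ln (1 + x) <= x] applied to the inverse, [1 / (1 + h) = 1 - h / (1 + h)]. *)
Lemma ln1D_ge (R : realType) (h : R) : -1 < h -> h / (1 + h) <= ln (1 + h).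
Proof.
move=> h_gt; have h1 : 0 < 1 + h by lra.
rewrite -[1 + h in leRHS]invrK lnV ?posrE ?invr_gt0 // lerNr.
rewrite [X in ln X](_ : _ = 1 + - (h / (1 + h))); last first.
  by field; rewrite lt0r_neq0.
apply: le_ln1Dx; rewrite ltrN2 ltr_pdivrMr //; lra.
Qed.

Section YuleSimon.
Variables (R : realType) (s : R).
Hypothesis s_gt0 : 0 < s.

(** The Yule-Simon mass [s * Beta(k, s + 1)], that is [p_inf] with a free parameter in place of
    [2 / phi a]. *)
Definition yule (k : nat) : R :=
  if k is 0%N then 0 else
  s * (Gamma (1 + s) * Gamma k%:R / Gamma (k%:R + 1 + s)).

Lemma yule1 : yule 1 = s / (1 + s).
Proof.
have s0 := s_gt0.
rewrite /yule Gamma1 -addrA [1 + (1 + s)]addrC GammaS; last by lra.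
have g : 0 < Gamma (1 + s) by apply: Gamma_gt0; lra.
by field; rewrite !lt0r_neq0 //; lra.
Qed.

Lemma yuleS (k : nat) :
  yule k.+2 * (k.+2%:R + s) = k.+1%:R * yule k.+1.
Proof.
have s0 := s_gt0.
rewrite /yule -(natr1 k.+1) GammaS ?ler1n //.
have k_gt0 : (0 : R) < k.+1%:R by rewrite ltr0n.
have -> : k.+1%:R + 1 + 1 + s = (k.+1%:R + 1 + s) + 1 by ring.
rewrite GammaS; last by lra.
have g : 0 < Gamma (k.+1%:R + 1 + s) by apply: Gamma_gt0; lra.
by field; rewrite !lt0r_neq0 //; lra.
Qed.

Lemma yule_gt0 (k : nat) : 0 < yule k.+1.
Proof.
have s0 := s_gt0.
have k_ge1 : (1 : R) <= k.+1%:R by rewrite ler1n.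
by rewrite mulr_gt0 // divr_gt0 ?mulr_gt0 ?Gamma_gt0 //; lra.
Qed.

Lemma yule_ge0 k : 0 <= yule k.
Proof. by case: k => // k; exact/ltW/yule_gt0. Qed.

(** Balance equation of the limiting degree proportions: vertices are born with degree [1] and leave
    degree [k] at rate [k / s]. *)
Lemma yule_rec k : yule k.+1 * (1 + k.+1%:R / s) = (k == 0)%:R + k%:R / s * yule k.
Proof.
have s0 := s_gt0.
case: k => [|k].
  have -> : (0%N == 0%N)%:R = 1 :> R by [].
  by rewrite !mul0r addr0 yule1; field; rewrite !lt0r_neq0 //; lra.
have -> : (k.+1 == 0%N)%:R = 0 :> R by [].
rewrite add0r; apply: (mulfI (lt0r_neq0 s_gt0)).
have -> : s * (yule k.+2 * (1 + k.+2%:R / s)) = yule k.+2 * (k.+2%:R + s).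
  by field; rewrite lt0r_neq0.
by rewrite yuleS; field; rewrite lt0r_neq0.
Qed.

(** The tail is explicit: by [yuleS], [(k + s) * yule k / s] decreases by exactly [yule k] from [k]
    to [k + 1]. *)
Lemma series_yule n : series yule n.+1 = 1 - n.+1%:R * yule n.+1 * (1 + s / n.+1%:R) / s.
Proof.
have s0 := s_gt0.
have n_gt0 m : (0 : R) < m.+1%:R by rewrite ltr0n.
elim: n => [|n IHn].
  rewrite seriesEnat [LHS]big_nat1 yule1 [yule 0]/yule.
  by field; rewrite !lt0r_neq0 //; lra.
rewrite seriesSr IHn -(natr1 n.+1).
have := yuleS n; rewrite -(natr1 n.+1) => h.
have -> : (n.+1%:R + 1) * yule n.+2 * (1 + s / (n.+1%:R + 1)) = n.+1%:R * yule n.+1.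
  by rewrite -h; field; rewrite lt0r_neq0 //; have := n_gt0 n; lra.
by field; rewrite !lt0r_neq0.
Qed.

(** Consecutive terms have ratio [1 - s / (n + 1 + s)], at most [1 - (s / (1 + s)) / (n + 1)]: a
    Robbins-Monro recursion without error. *)
Lemma cvg_n_yule : n%:R * yule n @[n --> \oo] --> 0.
Proof.
have s0 := s_gt0.
have s1 : 0 < s / (1 + s) by rewrite divr_gt0 //; lra.
apply: (@robbins_monro_cvg0 _ (s / (1 + s)) _ (fun=> 0)) => //.
- by near=> n; apply: mulr_ge0 => //; exact: yule_ge0.
- near=> n; rewrite mul0r addr0.
  have [m nE] : exists m, n = m.+1.
    by exists n.-1; rewrite prednK //; near: n; exact: nbhs_infty_gt.
  have m_gt0 : (0 : R) < m.+1%:R by rewrite ltr0n.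
  rewrite nE.
  have -> : yule m.+2 = m.+1%:R * yule m.+1 / (m.+2%:R + s).
    by rewrite -yuleS mulfK // lt0r_neq0 //; rewrite -natr1; lra.
  rewrite [leLHS](_ : _ = m.+1%:R * yule m.+1 * ((m.+2%:R + s)^-1 * m.+2%:R));
    last by ring.
  have my0 : 0 <= m.+1%:R * yule m.+1.
    by apply: mulr_ge0 => //; exact: yule_ge0.
  rewrite [leRHS]mulrC; apply: ler_wpM2l => //.
  rewrite -(natr1 m.+1) -subr_ge0.
  have -> : 1 - s / (1 + s) / (m.+1%:R + 1) - (m.+1%:R + 1 + s)^-1 * (m.+1%:R + 1) =
    s * s * m.+1%:R / ((1 + s) * (m.+1%:R + 1) * (m.+1%:R + 1 + s)).
    by field; rewrite !lt0r_neq0 //; lra.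
  rewrite divr_ge0 // ?mulr_ge0 //; lra.
- exact: cvg_cst.
Unshelve. all: by end_near. Qed.

Lemma cvg_yule : yule n @[n --> \oo] --> 0.
Proof.
have s0 := s_gt0.
apply: (@squeeze_cvgr _ _ _ _ (fun=> 0) (fun n => n%:R * yule n)).
- near=> n; rewrite yule_ge0 ler_peMl ?yule_ge0 // ler1n.
  by near: n; exact: nbhs_infty_gt.
- exact: cvg_cst.
- exact: cvg_n_yule.
Unshelve. all: by end_near. Qed.

Lemma yule_is_pmf : is_pmf yule.
Proof.
have s0 := s_gt0.
split; first exact: yule_ge0.
have l0 := cvg_n_yule; have l1 := cvg_yule.
rewrite -cvg_shiftS in l0; rewrite -cvg_shiftS in l1.
have L : 1 - (n.+1%:R * yule n.+1 + s * yule n.+1) / s @[n --> \oo] -->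
    1 - (0 + s * 0) / s.
  apply: cvgB; first exact: cvg_cst.
  apply: cvgM; last exact: cvg_cst.
  by apply: cvgD => //; apply: cvgM => //; exact: cvg_cst.
rewrite mulr0 addr0 mul0r subr0 in L.
rewrite -cvg_shiftS /=; apply: cvg_trans L; apply: near_eq_cvg; near=> n.
rewrite series_yule; congr (1 - _ / s).
by field; rewrite nat1r pnatr_eq0.
Unshelve. all: by end_near. Qed.

Let r := 1 + s.
(** The logarithm of [yule j * j ^ r] at [j = k + 1]: the power tail amounts to the convergence of
    [B]. *)
Let B (k : nat) : R := ln (yule k.+1) + r * ln k.+1%:R.

(* The increments of [B] are at most [r ^ 2 / ((k + 1) (k + 2))] in absolute
   value, which telescopes: [B k - r ^ 2 / (k + 1)] is nondecreasing and
   bounded above. *)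
Lemma is_cvg_ln_yule : cvgn B.
Proof.
have s0 := s_gt0.
have r1 : 1 < r by rewrite /r; lra.
have n_gt0 m : (0 : R) < m.+1%:R by rewrite ltr0n.
have step k : B k.+1 - B k =
    r * ln (1 + k.+1%:R^-1) - ln (1 + r / k.+1%:R).
  have y2 : yule k.+2 = yule k.+1 / (1 + r / k.+1%:R).
    have -> : yule k.+2 = k.+1%:R * yule k.+1 / (k.+2%:R + s).
      by rewrite -yuleS mulfK // lt0r_neq0 //; rewrite addr_gt0.
    rewrite -(natr1 k.+1) /r; field; rewrite !lt0r_neq0 //.
    have := n_gt0 k; lra.
  have k2 : k.+2%:R = k.+1%:R * (1 + k.+1%:R^-1) :> R.
    by rewrite mulrDr mulr1 divff ?lt0r_neq0 // natr1.
  have p1 : 0 < 1 + k.+1%:R^-1 :> R by rewrite addr_gt0 // invr_gt0.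
  have p2 : 0 < 1 + r / k.+1%:R by rewrite addr_gt0 // divr_gt0 //; lra.
  rewrite /B y2 k2; move: (yule k.+1) (yule_gt0 k) => y y_gt0.
  by rewrite ln_div ?posrE // lnM ?posrE //; ring.
have up k : B k.+1 - B k <= r ^+ 2 / (k.+1%:R * k.+2%:R).
  rewrite step.
  have h1 : ln (1 + k.+1%:R^-1) <= k.+1%:R^-1 :> R.
    by apply: le_ln1Dx; apply: lt_trans (_ : 0 < _); [lra|rewrite invr_gt0].
  have h2 : r / k.+1%:R / (1 + r / k.+1%:R) <= ln (1 + r / k.+1%:R).
    by apply: ln1D_ge; apply: lt_trans (_ : 0 < _); [lra|rewrite divr_gt0 //; lra].
  have h3 : r * ln (1 + k.+1%:R^-1) <= r * k.+1%:R^-1.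
    by rewrite ler_wpM2l //; lra.
  apply: le_trans (lerB h3 h2) _.
  rewrite -(natr1 k.+1); have := n_gt0 k; set x := k.+1%:R => x_gt0.
  rewrite -subr_ge0.
  have -> : r ^+ 2 / (x * (x + 1)) - (r * x^-1 - r / x / (1 + r / x)) =
    r ^+ 2 * (r - 1) / (x * (x + 1) * (x + r)).
    by field; rewrite !lt0r_neq0 //; lra.
  by rewrite divr_ge0 // !mulr_ge0 //; lra.
have lo k : - (r ^+ 2 / (k.+1%:R * k.+2%:R)) <= B k.+1 - B k.
  rewrite step.
  have h1 : ln (1 + r / k.+1%:R) <= r / k.+1%:R.
    by apply: le_ln1Dx; apply: lt_trans (_ : 0 < _); [lra|rewrite divr_gt0 //; lra].
  have h2 : k.+1%:R^-1 / (1 + k.+1%:R^-1) <= ln (1 + k.+1%:R^-1) :> R.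
    by apply: ln1D_ge; apply: lt_trans (_ : 0 < _); [lra|rewrite invr_gt0].
  have h3 : r * (k.+1%:R^-1 / (1 + k.+1%:R^-1)) <= r * ln (1 + k.+1%:R^-1).
    by rewrite ler_wpM2l //; lra.
  apply: le_trans (lerB h3 h1).
  rewrite -(natr1 k.+1); have := n_gt0 k; set x := k.+1%:R => x_gt0.
  rewrite -subr_ge0.
  have -> : r * (x^-1 / (1 + x^-1)) - r / x - - (r ^+ 2 / (x * (x + 1))) =
    r * (r - 1) / (x * (x + 1)).
    by field; rewrite !lt0r_neq0 //; lra.
  by rewrite divr_ge0 // !mulr_ge0 //; lra.
have tele k : r ^+ 2 / (k.+1%:R * k.+2%:R) = r ^+ 2 / k.+1%:R - r ^+ 2 / k.+2%:R.
  rewrite -(natr1 k.+1); have := n_gt0 k; set x := k.+1%:R => x_gt0.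
  by field; rewrite !lt0r_neq0 //; lra.
have Bub k : B k + r ^+ 2 / k.+1%:R <= B 0 + r ^+ 2.
  elim: k => [|k IHk]; first by rewrite divr1.
  apply: le_trans IHk; have := up k; rewrite tele.
  move: (B k) (B k.+1) (r ^+ 2 / k.+1%:R) (r ^+ 2 / k.+2%:R) => x y z t; lra.
have Acvg : cvgn (fun k => B k - r ^+ 2 / k.+1%:R).
  apply: nondecreasing_is_cvgn.
    apply/nondecreasing_seqP => k; have := lo k; rewrite tele.
    move: (B k) (B k.+1) (r ^+ 2 / k.+1%:R) (r ^+ 2 / k.+2%:R) => x y z t; lra.
  exists (B 0 + r ^+ 2) => _ [k _ <-]; apply: le_trans (Bub k).
  have : 0 <= r ^+ 2 / k.+1%:R by rewrite divr_ge0 // sqr_ge0.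
  move: (B k) (r ^+ 2 / k.+1%:R) => x y; lra.
have -> : B = (fun k => (B k - r ^+ 2 / k.+1%:R) + r ^+ 2 * harmonic k).
  by apply/funext => k; rewrite subrK.
apply: is_cvgD => //; apply: is_cvgM; first exact: is_cvg_cst.
by apply/cvg_ex; exists 0; exact: cvg_harmonic.
Qed.

(** The constant is the exponential of the limit of [B], hence positive without being computed. *)
Lemma yule_tail : exists2 c : R, 0 < c &
  yule ~_\oo (fun k : nat => c * k%:R `^ (- (1 + s))).
Proof.
have s0 := s_gt0.
exists (expR (limn B)); first exact: expR_gt0.
set c := expR _; have c_gt0 : 0 < c by exact: expR_gt0.
have lim : yule k * k%:R `^ r @[k --> \oo] --> c.
  rewrite -cvg_shiftS /=.
  have -> : (fun k => yule k.+1 * k.+1%:R `^ r) = expR \o B.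
    apply/funext => k; rewrite /B /= expRD lnK ?posrE ?yule_gt0 //.
    by rewrite /powR pnatr_eq0.
  by apply: continuous_cvg; [exact: continuous_expR|exact: is_cvg_ln_yule].
apply/eqaddoP => e e_gt0.
have /cvgrPdist_le/(_ _ (mulr_gt0 e_gt0 c_gt0)) := lim.
apply: filter_app; near=> k => h.
have k_gt0 : (0 : R) < k%:R by rewrite ltr0n; near: k; exact: nbhs_infty_gt.
have p_gt0 : 0 < k%:R `^ r by rewrite powR_gt0.
change (`|yule k - c * k%:R `^ (- r)| <= e * `|c * k%:R `^ (- r)|).
rewrite powRN.
have -> : (yule k - c / k%:R `^ r) = - ((c - yule k * k%:R `^ r) / k%:R `^ r).
  by field; rewrite lt0r_neq0.
rewrite normrN !normrM [`|(_ `^ _)^-1|]gtr0_norm ?invr_gt0 // [`|c|]gtr0_norm //.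
by rewrite mulrA ler_pM2r ?invr_gt0.
Unshelve. all: by end_near. Qed.

End YuleSimon.

(** * A strong law for network statistics *)

Lemma bracket_pow4 (n : nat) : (0 < n)%N ->
  exists2 k : nat, (0 < k)%N & (k ^ 4 <= n < k.+1 ^ 4)%N.
Proof.
move=> n_gt0.
have ex : exists k, (k ^ 4 <= n)%N by exists 0%N.
have ub k : (k ^ 4 <= n)%N -> (k <= n)%N.
  by apply: leq_trans; rewrite -{1}(expn1 k); case: k => // k; rewrite leq_pexp2l.
case: (ex_maxnP ex ub) => k kn kmax; exists k.
  by have := kmax 1%N; rewrite exp1n => /(_ n_gt0).
by rewrite kn ltnNge; apply/negP => /kmax; rewrite ltnn.
Qed.

(* The powers [k ^ 4] are sparse enough for Borel-Cantelli with a variance of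
   order [n] and thresholds [k ^ 3], and dense enough for a Lipschitz sequence
   to vary by [O(k ^ 3)] between two of them. *)
Lemma cvg0_of_subseq_pow4 (R : realType) (M : nat -> R) (C : R) :
  (forall n, `|M n.+1 - M n| <= C) ->
  (\forall k \near \oo, `|M (k ^ 4)%N| <= k%:R ^+ 3) ->
  M n / n%:R @[n --> \oo] --> 0.
Proof.
move=> M_lip [K _ M_le].
have C_ge0 : 0 <= C := le_trans (normr_ge0 _) (M_lip 0%N).
have lip n j : `|M (n + j)%N - M n| <= C * j%:R.
  elim: j => [|j IHj]; first by rewrite addn0 subrr normr0 mulr0.
  rewrite addnS -natr1 mulrDr mulr1.
  have -> : M (n + j).+1 - M n = (M (n + j)%N - M n) + (M (n + j).+1 - M (n + j)%N) by ring.
  by apply: le_trans (ler_normD _ _) _; apply: lerD.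
apply/cvgr0Pnorm_le => /= e e_gt0.
(* For [k >= 1], [(k + 1) ^ 4 - k ^ 4 <= 15 k ^ 3]. With the bound [k ^ 3] at [k ^ 4], this gives
   [|M n| <= (1 + 15 C) k ^ 3], to be compared with [e * k ^ 4 <= e * n]. *)
have [L _ L_le] := nbhs_infty_ger ((1 + 15 * C) / e).
exists (maxn K L ^ 4)%N => //= n n_ge.
(* The index [0] is in range when [K = L = 0]; there the quotient is [0] by convention. *)
have [->|n_gt0] := posnP n; first by rewrite invr0 mulr0 normr0 ltW.
have n_gt0R : (0 : R) < n%:R by rewrite ltr0n.
have [k k_gt0 /andP[kn nk]] := bracket_pow4 n_gt0.
have : (maxn K L <= k)%N.
  by rewrite -ltnS -(@ltn_exp2r _ _ 4) // (leq_ltn_trans n_ge).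
rewrite geq_max => /andP[Kk Lk].
have k1 : (1 : R) <= k%:R by rewrite ler1n.
have h1 := M_le k Kk; have := L_le k Lk; rewrite /= ler_pdivrMr // => h2.
have := lip (k ^ 4)%N (n - k ^ 4)%N; rewrite subnKC // natrB // natrX => h3.
have kn4 : k%:R ^+ 4 <= n%:R :> R by rewrite -natrX ler_nat.
have nk4 : n%:R <= (k%:R + 1) ^+ 4 :> R by rewrite natr1 -natrX ler_nat ltnW.
rewrite normrM [`|n%:R^-1|]gtr0_norm ?invr_gt0 // ler_pdivrMr //.
have h4 : `|M n| <= `|M (k ^ 4)%N| + `|M n - M (k ^ 4)%N|.
  have := ler_normD (M (k ^ 4)%N) (M n - M (k ^ 4)%N).
  by rewrite (_ : M (k ^ 4)%N + (M n - M (k ^ 4)%N) = M n) //; ring.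
have h5 : n%:R - k%:R ^+ 4 <= 15 * k%:R ^+ 3 :> R.
  have : k%:R ^+ 2 <= k%:R ^+ 3 :> R by rewrite ler_weXn2l.
  have : k%:R <= k%:R ^+ 3 :> R by rewrite -[leLHS]expr1 ler_weXn2l.
  have : 1 <= k%:R ^+ 3 :> R by rewrite exprn_ege1.
  move: nk4; rewrite (_ : (k%:R + 1) ^+ 4 =
    k%:R ^+ 4 + 4 * k%:R ^+ 3 + 6 * k%:R ^+ 2 + 4 * k%:R + 1); last by ring.
  lra.
have h6 : C * (n%:R - k%:R ^+ 4) <= C * (15 * k%:R ^+ 3) by rewrite ler_wpM2l.
have h7 : (1 + 15 * C) * k%:R ^+ 3 <= k%:R * e * k%:R ^+ 3.
  by rewrite ler_wpM2r // exprn_ge0.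
have h8 : e * k%:R ^+ 4 <= e * n%:R by rewrite ler_wpM2l // ltW.
have : k%:R * e * k%:R ^+ 3 = e * k%:R ^+ 4 by ring.
lra.
Qed.

(** Orthogonality of martingale increments for one step: the increment is centred, so its cross term
    with [M] vanishes, and its variance is at most its second moment. *)
Lemma weighted_second_moment (R : realFieldType) (I : finType) (p x : I -> R)
    (M c : R) :
  (forall i, 0 <= p i) -> \sum_i p i = 1 -> (forall i, `|x i| <= c) ->
  \sum_i p i * (M + (x i - \sum_j p j * x j)) ^+ 2 <= M ^+ 2 + c ^+ 2.
Proof.
move=> p_ge0 p1 x_le; set xbar := \sum_j p j * x j.
have -> : \sum_i p i * (M + (x i - xbar)) ^+ 2 =
    M ^+ 2 + \sum_i p i * x i ^+ 2 - xbar ^+ 2.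
  transitivity (\sum_i ((M - xbar) ^+ 2 * p i + 2 * (M - xbar) * (p i * x i)
      + p i * x i ^+ 2)); first by apply: eq_bigr => i _; ring.
  rewrite !big_split /= -!mulr_sumr p1 -/xbar; ring.
rewrite lerBlDr -addrA lerD2l.
apply: le_trans (_ : c ^+ 2 <= _); last by rewrite lerDl sqr_ge0.
rewrite -[leRHS]mul1r -p1 mulr_suml; apply: ler_sum => i _.
rewrite ler_wpM2l // -real_normK ?num_real // lerXn2r ?nnegrE //.
exact: le_trans (x_le i).
Qed.

Section FiniteCover.
Context {d : measure_display} {T : measurableType d} {R : realType}.
Variables (P : probability T R) (I : finType) (F : I -> set T).
Hypothesis mF : forall i, measurable (F i).

Lemma fin_bigcup_setU :
  [set w | exists i, F i w] = \big[setU/set0]_(i : I) F i.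
Proof.
rewrite -bigcup_seq; apply/seteqP.
by split => [w [i Fi]|w [i _ Fi]]; exists i => //=; rewrite mem_index_enum.
Qed.

Lemma measurable_fin_bigcup : measurable [set w | exists i, F i w].
Proof. by rewrite fin_bigcup_setU; exact: bigsetU_measurable. Qed.

Lemma fine_probability_fin_bigcup :
  fine (P [set w | exists i, F i w]) <= \sum_i fine (P (F i)).
Proof.
rewrite fin_bigcup_setU; elim: (index_enum I) => [|i s IHs].
  by rewrite !big_nil measure0.
rewrite !big_cons; apply: (@le_trans _ _ (fine (P (F i)) +
    fine (P (\big[setU/set0]_(j <- s) F j)))); last by rewrite lerD2l.
have mU : measurable (\big[setU/set0]_(j <- s) F j) by exact: bigsetU_measurable.
rewrite -lee_fin EFinD !fineK ?fin_num_measure //; last exact: measurableU.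
exact: measureU2.
Qed.

End FiniteCover.

(** * Compensated statistics and attachment histories *)

Section NetworkProcess.
Context {d : measure_display} {T : measurableType d} {R : realType}.
Variables (m : nat) (P : probability T R).
Variables (pi : 'I_m.+1 -> R) (kappa : 'M[R]_m.+1) (g0 : network m).
Variables (tau : nat -> T -> 'I_m.+1) (alpha : nat -> T -> nat).
Hypothesis hpi : is_pmf_on_types pi.
Hypothesis hG : is_network_process P pi kappa g0 tau alpha.
Implicit Types (g : network m) (h : nat -> network m) (f : network m -> R).

(** Conditional law of the pair (type, parent) of the next vertex; parents are ordinals so that the
    possible steps form a finite type. *)
Definition attach_weight (g : network m) (i : 'I_m.+1 * 'I_(gorder g)) : R :=
  pi i.1 * attach_prob kappa g0 g i.1 i.2.

Arguments attach_weight : clear implicits.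

Definition drift f g : R :=
  \sum_i attach_weight g i * (f (attach g i.2 i.1) - f g).

(** The martingale part of the Doob decomposition, as a function of an arbitrary history [h], so
    that it can be evaluated on atoms. *)
Definition compensated f h n : R :=
  f (h n) - f (h 0%N) - \sum_(i < n) drift f (h i).

Definition extend h k g i := if (i <= k)%N then h i else g.

(** [attach] is injective in the vertex and the type, which are read off the last edge and the last
    type, so the next step is determined by the extended history. *)
Lemma history_extend h k b v :
  history g0 tau alpha k.+1 (extend h k (attach (h k) v b)) =
  history g0 tau alpha k h `&` [set w | tau k w = b] `&` [set w | alpha k w = v].
Proof.
apply/seteqP; split => w /=.
  move=> hw.
  have hist : history g0 tau alpha k h w.
    by move=> i ik; rewrite hw /extend ?ik // (leq_trans ik).
  have := hw k.+1 (leqnn _); rewrite /extend ltnn /= (hist k (leqnn _)).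
  by case=> /rcons_inj[bE] /rcons_inj[vE].
case=> -[hist bE] vE i; rewrite leq_eqVlt ltnS => /predU1P[->|ik].
  by rewrite /extend ltnn /= (hist k (leqnn _)) bE vE.
by rewrite /extend ik; exact: hist.
Qed.

Lemma compensatedS f h n : compensated f h n.+1 =
  compensated f h n + (f (h n.+1) - f (h n) - drift f (h n)).
Proof. by rewrite /compensated big_ord_recr /=; ring. Qed.

Lemma eq_compensated f h h' n : (forall i, (i <= n)%N -> h i = h' i) ->
  compensated f h n = compensated f h' n.
Proof.
move=> hh'; rewrite /compensated !hh' //; congr (_ - _).
by apply: eq_bigr => i _; rewrite hh' // ltnW.
Qed.

(** [inv] is a class of networks stable under growth on which the attachment weights form a law; it
    is instantiated with [wf_network]. *)
Variables (inv : network m -> Prop) (f : network m -> R) (c : R).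
Hypothesis inv_g0 : inv g0.
Hypothesis inv_attach : forall g v b, inv g -> (v < gorder g)%N ->
  inv (attach g v b).
Hypothesis attach_prob_ge0 : forall g b v, inv g ->
  0 <= attach_prob kappa g0 g b v.
Hypothesis sum_attach_prob : forall g b, inv g ->
  \sum_(v < gorder g) attach_prob kappa g0 g b v = 1.
Hypothesis f_lip : forall g v b, inv g -> (v < gorder g)%N ->
  `|f (attach g v b) - f g| <= c.

Lemma attach_weight_ge0 g i : inv g -> 0 <= attach_weight g i.
Proof. by move=> ig; rewrite mulr_ge0 ?attach_prob_ge0 //; case: hpi. Qed.

Lemma sum_attach_weight g : inv g -> \sum_i attach_weight g i = 1.
Proof.
move=> ig; rewrite /attach_weight -(pair_bigA _
  (fun b (v : 'I_(gorder g)) => pi b * attach_prob kappa g0 g b v)) /=.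
under eq_bigr do rewrite -mulr_sumr sum_attach_prob // mulr1.
by case: hpi.
Qed.

Lemma drift_le g : inv g -> `|drift f g| <= c.
Proof.
move=> ig; apply: le_trans (ler_norm_sum _ _ _) _.
rewrite -[leRHS]mul1r -(sum_attach_weight ig) mulr_suml.
apply: ler_sum => i _; rewrite normrM ger0_norm ?attach_weight_ge0 //.
by rewrite ler_wpM2l ?attach_weight_ge0 // f_lip.
Qed.

Lemma net_inv n w : inv (net g0 tau alpha n w).
Proof.
elim: n => [|n IHn] //=; apply: inv_attach => //; exact: (np_alpha_vertex hG).
Qed.

Let hist := history g0 tau alpha.
Let exceed (t : R) n : set T :=
  [set w | t <= `|compensated f (fun i => net g0 tau alpha i w) n|].

(** Measurability of atoms is propagated one step at a time along with their probability, starting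
    from the sure event at time [0]. *)
Lemma history_extend_law h k b v : inv (h k) -> (v < gorder (h k))%N ->
  measurable (hist k h) ->
  measurable (hist k.+1 (extend h k (attach (h k) v b))) /\
  fine (P (hist k.+1 (extend h k (attach (h k) v b)))) =
  fine (P (hist k h)) * (pi b * attach_prob kappa g0 (h k) b v).
Proof.
move=> ihk vk mh; rewrite /hist history_extend.
have mt : measurable [set w | tau k w = b] := np_measurable_tau hG k b.
have ma : measurable [set w | alpha k w = v] := np_measurable_alpha hG k v.
split; first by apply: measurableI => //; exact: measurableI.
rewrite (np_alpha_law hG) // (np_tau_indep hG) (np_tau_law hG).
have pf : P (history g0 tau alpha k h) \is a fin_num by exact: fin_num_measure.
by rewrite !fineM ?fin_numM //= -mulrA.
Qed.

(* Conditional Doob decomposition, by induction on the number [j] of remaining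
   steps: splitting a history along the next attachment costs [c ^ 2]. *)
Lemma history_second_moment (t : R) n : 0 <= t ->
  forall j k h, (k + j = n)%N -> inv (h k) -> measurable (hist k h) ->
  measurable (hist k h `&` exceed t n) /\
  fine (P (hist k h `&` exceed t n)) * t ^+ 2 <=
  fine (P (hist k h)) * (compensated f h k ^+ 2 + c ^+ 2 * j%:R).
Proof.
move=> t_ge0; elim=> [|j IHj] k h.
  rewrite addn0 => -> ihn mh; rewrite mulr0 addr0.
  (* The compensated statistic is constant on an atom of time [n], which therefore lies inside
     [exceed t n] or is disjoint from it. *)
  have cE w : hist n h w ->
      compensated f (fun i => net g0 tau alpha i w) n = compensated f h n.
    by move=> hw; apply: eq_compensated => i; exact: hw.
  have [tle|tgt] := leP t `|compensated f h n|.
    have -> : hist n h `&` exceed t n = hist n h.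
      by apply/setIidPl => w hw; rewrite /exceed /= cE.
    split=> //; rewrite ler_wpM2l ?fine_ge0 ?measure_ge0 //.
    by rewrite -[leRHS]real_normK ?num_real // lerXn2r ?nnegrE.
  have -> : hist n h `&` exceed t n = set0.
    apply/seteqP; split => // w [hw]; rewrite /exceed /= cE //.
    by rewrite leNgt tgt.
  by rewrite measure0 mul0r mulr_ge0 ?sqr_ge0 ?fine_ge0 ?measure_ge0.
rewrite addnS => kn ihk mh.
pose h' (i : 'I_m.+1 * 'I_(gorder (h k))) := extend h k (attach (h k) i.2 i.1).
have h'k i : h' i k.+1 = attach (h k) i.2 i.1 by rewrite /h' /extend ltnn.
have ih' i : inv (h' i k.+1) by rewrite h'k; exact: inv_attach.
have law' i := history_extend_law i.1 ihk (ltn_ord i.2) mh.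
have {}IHj i := IHj k.+1 (h' i) kn (ih' i) (law' i).1.
pose F i := hist k.+1 (h' i) `&` exceed t n.
have -> : hist k h `&` exceed t n = [set w | exists i, F i w].
  apply/seteqP; split => [w [hw ew]|w [i []]].
    have ak : (alpha k w < gorder (h k))%N.
      by rewrite -(hw k (leqnn _)); exact: (np_alpha_vertex hG).
    exists (tau k w, Ordinal ak); split => //.
    by rewrite /hist history_extend.
  by rewrite /hist history_extend => -[[]].
have mF i : measurable (F i) := (IHj i).1.
split; first exact: measurable_fin_bigcup.
(* The union bound loses nothing here, since the weights of the one-step extensions sum to [1]. *)
apply: le_trans (ler_wpM2r (sqr_ge0 t) (fine_probability_fin_bigcup P mF)) _.
rewrite mulr_suml; apply: le_trans (ler_sum _ (fun i _ => (IHj i).2)) _.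
pose x (i : 'I_m.+1 * 'I_(gorder (h k))) := f (attach (h k) i.2 i.1) - f (h k).
have cE i : compensated f (h' i) k.+1 =
    compensated f h k + (x i - \sum_j attach_weight (h k) j * x j).
  rewrite compensatedS h'k; congr (_ + _).
    by apply: eq_compensated => l lk; rewrite /h' /extend lk.
  by rewrite /h' /extend leqnn.
have wE i : fine (P (hist k.+1 (h' i))) =
  fine (P (hist k h)) * attach_weight (h k) i := (law' i).2.
under eq_bigr => i _ do rewrite cE wE -mulrA.
rewrite -mulr_sumr ler_wpM2l ?fine_ge0 ?measure_ge0 //.
have x_le i : `|x i| <= c by exact: f_lip.
have := weighted_second_moment (compensated f h k)
  (fun i => attach_weight_ge0 i ihk) (sum_attach_weight ihk) x_le.
under [X in _ -> X <= _]eq_bigr do rewrite mulrDr.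
rewrite big_split /= -mulr_suml sum_attach_weight // mul1r -natr1; lra.
Qed.

Lemma chebyshev_compensated (t : R) n : 0 <= t ->
  measurable (exceed t n) /\
  fine (P (exceed t n)) * t ^+ 2 <= c ^+ 2 * n%:R.
Proof.
move=> t_ge0.
have hT : hist 0 (fun=> g0) = setT.
  by apply/seteqP; split => // w _ i; rewrite leqn0 => /eqP ->.
have := @history_second_moment t n t_ge0 n 0%N (fun=> g0) (add0n n) inv_g0.
rewrite hT setTI probability_setT /compensated big_ord0 !subrr expr0n /= add0r mul1r.
by apply; exact: measurableT.
Qed.

Lemma compensated_lip w n :
  let M := compensated f (fun i => net g0 tau alpha i w) in
  `|M n.+1 - M n| <= 2 * c.
Proof.
rewrite /= compensatedS addrC addKr.
apply: le_trans (ler_normB _ _) _; rewrite mulrDl !mul1r; apply: lerD.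
  by apply: f_lip; [exact: net_inv|exact: (np_alpha_vertex hG)].
by apply: drift_le; exact: net_inv.
Qed.

(** The induction carries the stronger bound [2 - 1 / n] for [n >= 1] terms. *)
Lemma sum_inv_sqr_le n : \sum_(0 <= i < n) (i.+1%:R ^+ 2)^-1 <= 2 :> R.
Proof.
case: n => [|n]; first by rewrite big_nil.
apply: (@le_trans _ _ (2 - n.+1%:R^-1)); last by rewrite gerBl invr_ge0.
elim: n => [|n IHn]; first by rewrite big_nat1 expr1n invr1; lra.
rewrite big_nat_recr //= -(natr1 n.+1).
apply: le_trans (lerD IHn (lexx _)) _.
have : (0 : R) < n.+1%:R by rewrite ltr0n.
move: n.+1%:R => x x_gt0; rewrite -subr_ge0.
have -> : 2 - (x + 1)^-1 - (2 - x^-1 + ((x + 1) ^+ 2)^-1) =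
  (x * (x + 1) ^+ 2)^-1.
  by field; rewrite !lt0r_neq0 //; lra.
by rewrite invr_ge0 mulr_ge0 ?sqr_ge0 // ltW.
Qed.

Lemma network_slln : {ae P, forall w,
  compensated f (fun i => net g0 tau alpha i w) n / n%:R @[n --> \oo] --> (0 : R)}.
Proof.
(* Chebyshev gives [c ^ 2 * (k + 1) ^ 4 / (k + 1) ^ 6], which is summable; the shift keeps the
   threshold positive. *)
pose F k := exceed (k.+1%:R ^+ 3) (k.+1 ^ 4)%N.
have F_bnd k : measurable (F k) /\ (P (F k) <= (c ^+ 2 * (k.+1%:R ^+ 2)^-1)%:E)%E.
  have t_ge0 : (0 : R) <= k.+1%:R ^+ 3 by rewrite exprn_ge0.
  have [mF leF] := chebyshev_compensated (k.+1 ^ 4)%N t_ge0.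
  split=> //; rewrite -(fineK (fin_num_measure P _ mF)) lee_fin.
  have x_gt0 : (0 : R) < k.+1%:R by rewrite ltr0n.
  rewrite ler_pdivlMr ?exprn_gt0 // -(ler_pM2r (exprn_gt0 4 x_gt0)).
  by rewrite natrX in leF; apply: le_trans leF; rewrite le_eqVlt; apply/orP; left; apply/eqP; ring.
have mF k := (F_bnd k).1.
have F0 : P (lim_sup_set F) = 0.
  apply: lim_sup_set_cvg0 => //.
  apply: (@le_lt_trans _ _ (c ^+ 2 * 2)%:E); last exact: ltry.
  apply: lime_le; first exact: is_cvg_nneseries.
  near=> n.
  apply: (@le_trans _ _ (\sum_(0 <= i < n) (c ^+ 2 * (i.+1%:R ^+ 2)^-1)%:E)%E).
    by apply: lee_sum => k _; exact: (F_bnd k).2.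
  by rewrite sumEFin lee_fin -mulr_sumr ler_wpM2l ?sqr_ge0 // sum_inv_sqr_le.
apply: (@negligibleS _ _ _ _ (lim_sup_set F)); last first.
  apply/negligibleP => //; apply: bigcap_measurable => // n _.
  by apply: bigcup_measurable => k _.
move=> w /=; apply: contra_notP => wF.
apply: (@cvg0_of_subseq_pow4 _ _ (2 * c)); first exact: compensated_lip.
have [n nF] : exists n, forall k, (n <= k)%N -> ~ F k w.
  apply: contra_notP wF => nex n _ /=; apply: contra_notP nex => nbig.
  by exists n => k nk Fk; apply: nbig; exists k.
exists n.+1 => // -[//|k] /= nk.
by rewrite leNgt; apply/negP => /ltW; exact: (nF k nk).
Unshelve. all: by end_near. Qed.

End NetworkProcess.

(** * Drifts of network statistics *)

Section NetworkStatistics.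
Variables (R : realType) (m : nat).
Variables (pi : 'I_m.+1 -> R) (kappa : 'M[R]_m.+1) (g0 : network m).
Implicit Types (g : network m) (a b t : 'I_m.+1) (u v k j : nat).
Implicit Types (F : 'I_m.+1 -> nat -> R).

(** Vertex counts, degree sums and normalising constants all have this additive form, so increments
    and drifts are computed once. *)
Definition stat F g : R := \sum_(u < gorder g) F (vtype g u) (deg g0 g u).

Definition type_degree a := stat (fun t j => (t == a)%:R * j%:R).
Definition total_degree := stat (fun _ j => j%:R).
Definition type_count a := stat (fun t _ => (t == a)%:R).
Definition degree_count a k := stat (fun t j => (t == a)%:R * (j == k)%:R).
Definition attractivity b := stat (fun t j => kappa t b * j%:R).

(** The first two clauses make a new vertex start at degree [1]: its number is not [0], which may
    carry the initial extra degree, and no earlier edge mentions it. The third makes the attachment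
    probabilities well defined. *)
Definition wf_network g : Prop :=
  [/\ (0 < gorder g0 <= gorder g)%N,
      all (fun e => (e.1 < gorder g) && (e.2 < gorder g))%N (nedges g) &
      0 < total_degree g].

Lemma gorder_attach g v b : gorder (attach g v b) = (gorder g).+1.
Proof. by rewrite /gorder size_rcons. Qed.

Lemma vtype_attach g v b u : (u < gorder g)%N ->
  vtype (attach g v b) u = vtype g u.
Proof. by rewrite /vtype nth_rcons /gorder => ->. Qed.

Lemma vtype_attach_new g v b : vtype (attach g v b) (gorder g) = b.
Proof. by rewrite /vtype nth_rcons ltnn eqxx. Qed.

Lemma deg_attach g v b u : (u < gorder g)%N ->
  deg g0 (attach g v b) u = (deg g0 g u + (v == u))%N.
Proof.
move=> ug; rewrite /deg /= -cats1 count_cat /= addn0.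
by rewrite [gorder g == u]gtn_eqF // orbF addnAC.
Qed.

Lemma deg_attach_new g v b : wf_network g -> (v < gorder g)%N ->
  deg g0 (attach g v b) (gorder g) = 1%N.
Proof.
move=> [/andP[g00 g0g] /allP eg _] vg.
rewrite /deg /= -cats1 count_cat /= eqxx orbT addn0 (gtn_eqF (leq_trans g00 g0g)) andbF addn0.
rewrite (_ : count _ _ = 0%N) //; apply/eqP; rewrite -leqn0 leqNgt -has_count.
apply/hasP => -[e /eg /andP[e1 e2]].
by rewrite (ltn_eqF e1) (ltn_eqF e2).
Qed.

Lemma stat_attach F g v b : wf_network g -> (v < gorder g)%N ->
  stat F (attach g v b) - stat F g =
  F b 1%N + (F (vtype g v) (deg g0 g v).+1 - F (vtype g v) (deg g0 g v)).
Proof.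
move=> wg vg; rewrite /stat gorder_attach big_ord_recr /=.
rewrite vtype_attach_new deg_attach_new // addrAC [RHS]addrC; congr (_ + _).
rewrite -sumrB (bigD1 (Ordinal vg)) //= big1 ?addr0 => [|u].
  by rewrite vtype_attach // deg_attach // eqxx addn1.
rewrite -val_eqE /= => uv.
by rewrite vtype_attach // deg_attach // eq_sym (negbTE uv) addn0 subrr.
Qed.

Lemma total_degree_attach g v b : wf_network g -> (v < gorder g)%N ->
  total_degree (attach g v b) = total_degree g + 2.
Proof.
move=> wg vg; rewrite -[LHS](subrK (total_degree g)) stat_attach //.
by rewrite -(natr1 (deg g0 g v)); ring.
Qed.

Lemma wf_attach g v b : wf_network g -> (v < gorder g)%N ->
  wf_network (attach g v b).
Proof.
move=> wg vg; have [/andP[g00 g0g] eg tg] := wg; split.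
- by rewrite g00 gorder_attach ltnW.
- rewrite gorder_attach all_rcons /= ltnS (ltnW vg) ltnSn /=.
  by apply: sub_all eg => e /andP[e1 e2]; rewrite !ltnS (ltnW e1) (ltnW e2).
- by rewrite total_degree_attach // addr_gt0.
Qed.

(** A single vertex has positive degree by the initial convention; otherwise a path from vertex [0]
    to vertex [1] provides an edge at [0]. *)
Lemma wf_tree : is_tree g0 -> wf_network g0.
Proof.
move=> [g00 /andP[_ /allP eg] conn _]; split.
- by rewrite g00 leqnn.
- apply/allP => e /eg /andP[e12 e2]; by rewrite e2 (ltn_trans e12).
- rewrite /total_degree /stat -natr_sum ltr0n lt0n sum_nat_eq0.
  apply/negP => /forallP /= deg0.
  have d0 u : (u < gorder g0)%N -> deg g0 g0 u = 0%N.
    by move=> ug; apply/eqP; exact: (deg0 (Ordinal ug)).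
  have [g01|g0n1] := eqVneq (gorder g0) 1%N.
    by have := d0 0%N g00; rewrite /deg g01 eqxx /= addn1.
  have g01 : (1 < gorder g0)%N by rewrite ltn_neqAle eq_sym g0n1.
  have := conn (Ordinal g00) (Ordinal g01).
  move=> /connectP[[|u p] /=]; first by move=> _ /(congr1 val).
  move=> /andP[] + _ _; rewrite /adj /=.
  have := d0 0%N g00; rewrite /deg => /eqP; rewrite addn_eq0 => /andP[].
  rewrite -leqn0 leqNgt -has_count => /hasPn no _.
  by case/orP => /no /=; rewrite ?eqxx ?orbT.
Qed.

Lemma sum_vertices (G : nat -> R) g :
  \sum_(u <- vertices g) G u = \sum_(u < gorder g) G u.
Proof. by rewrite /vertices -{1}[gorder g]subn0 big_mkord. Qed.

Hypothesis kappa_gt0 : forall a b, 0 < kappa a b.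

Lemma statZ (c : R) F g : stat (fun t j => c * F t j) g = c * stat F g.
Proof. by rewrite /stat mulr_sumr. Qed.

Lemma stat_sum (I : finType) (G : I -> 'I_m.+1 -> nat -> R) g :
  \sum_i stat (G i) g = stat (fun t j => \sum_i G i t j) g.
Proof. by rewrite /stat exchange_big. Qed.

Lemma statD F F' g : stat (fun t j => F t j + F' t j) g = stat F g + stat F' g.
Proof. by rewrite /stat big_split. Qed.

Lemma eq_stat F F' g : (forall t j, F t j = F' t j) -> stat F g = stat F' g.
Proof. by move=> FF'; apply: eq_bigr. Qed.

Lemma sum_indicator (G : 'I_m.+1 -> R) t : \sum_a (t == a)%:R * G a = G t.
Proof.
rewrite (bigD1 t) //= eqxx mul1r big1 ?addr0 // => a at_.
by rewrite eq_sym (negbTE at_) mul0r.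
Qed.

Lemma type_degree_ge0 a g : 0 <= type_degree a g.
Proof. by apply: sumr_ge0 => u _; rewrite mulr_ge0. Qed.

Lemma sum_type_degree g : \sum_a type_degree a g = total_degree g.
Proof.
rewrite stat_sum; apply: eq_stat => t j.
exact: (sum_indicator (fun=> j%:R)).
Qed.

Lemma attractivityE b g :
  attractivity b g = \sum_a kappa a b * type_degree a g.
Proof.
under eq_bigr do rewrite -statZ.
rewrite stat_sum; apply: eq_stat => t j.
rewrite -(sum_indicator (fun a => kappa a b * j%:R)).
by apply: eq_bigr => a _; rewrite mulrCA.
Qed.

Lemma attractivity_gt0 b g : wf_network g -> 0 < attractivity b g.
Proof.
move=> [_ _ tg]; rewrite attractivityE lt_neqAle sumr_ge0; last first.
  by move=> a _; rewrite mulr_ge0 ?type_degree_ge0 // ltW.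
rewrite andbT eq_sym; apply: contraTneq tg => /eqP.
rewrite psumr_eq0; last by move=> a _; rewrite mulr_ge0 ?type_degree_ge0 // ltW.
move=> /allP X0; rewrite -sum_type_degree big1 ?ltxx // => a _.
have /implyP/(_ isT) := X0 a (mem_index_enum a).
by rewrite mulf_eq0 gt_eqF //= => /eqP.
Qed.

Lemma attach_probE g b v : attach_prob kappa g0 g b v =
  kappa (vtype g v) b * (deg g0 g v)%:R / attractivity b g.
Proof. by rewrite /attach_prob sum_vertices. Qed.

Lemma attach_prob_ge0 g b v : wf_network g -> 0 <= attach_prob kappa g0 g b v.
Proof.
move=> wg; rewrite attach_probE divr_ge0 ?mulr_ge0 // ltW //.
exact: attractivity_gt0.
Qed.

Lemma sum_attach_prob g b : wf_network g ->
  \sum_(v < gorder g) attach_prob kappa g0 g b v = 1.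
Proof.
move=> wg; under eq_bigr do rewrite attach_probE.
by rewrite -mulr_suml divff // gt_eqF // attractivity_gt0.
Qed.

(** When the increment depends on the parent only through its type and degree, averaging over
    parents yields additive statistics again. *)
Lemma driftE (f : network m -> R) (Psi : 'I_m.+1 -> 'I_m.+1 -> nat -> R) g :
  (forall v b, (v < gorder g)%N ->
     f (attach g v b) - f g = Psi b (vtype g v) (deg g0 g v)) ->
  drift pi kappa g0 f g =
  \sum_b pi b / attractivity b g *
    stat (fun t j => kappa t b * j%:R * Psi b t j) g.
Proof.
move=> fE; rewrite /drift /attach_weight -(pair_bigA _
  (fun b (v : 'I_(gorder g)) => pi b * attach_prob kappa g0 g b v *
     (f (attach g v b) - f g))) /=.
apply: eq_bigr => b _; rewrite /stat mulr_sumr; apply: eq_bigr => v _.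
by rewrite fE // attach_probE; ring.
Qed.

(** Conditional probability that a given unit of degree of type [a] attracts the next vertex. *)
Definition attach_rate a g : R := \sum_b pi b * kappa a b / attractivity b g.

(** The parent is chosen proportionally to its degree [j], so only [j * (F t j.+1 - F t j)] matters;
    when it is supported on the single type [a], the factor [kappa a b] comes out of the sum. *)
Lemma drift_stat F a (H : nat -> R) g : wf_network g ->
  (forall t j, j%:R * (F t j.+1 - F t j) = (t == a)%:R * H j) ->
  drift pi kappa g0 (stat F) g =
  \sum_b pi b * F b 1%N +
  attach_rate a g * stat (fun t j => (t == a)%:R * H j) g.
Proof.
move=> wg FH; rewrite (driftE (Psi := fun b t j => F b 1%N + (F t j.+1 - F t j))); last first.
  by move=> v b vg; rewrite stat_attach.
rewrite /attach_rate mulr_suml -big_split /=; apply: eq_bigr => b _.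
have Z_gt0 := attractivity_gt0 b wg.
rewrite (eq_stat (F' := fun t j => F b 1%N * (kappa t b * j%:R) +
   kappa a b * ((t == a)%:R * H j))); last first.
  move=> t j; rewrite mulrDr -[_ * _ * (F t j.+1 - _)]mulrA FH mulrC; congr (_ + _).
  by case: eqP => [->|_] //; rewrite !mul0r !mulr0.
rewrite statD !statZ -/(attractivity b); field; exact: lt0r_neq0.
Qed.

Lemma drift_type_degree a g : wf_network g ->
  drift pi kappa g0 (type_degree a) g =
  pi a + attach_rate a g * type_degree a g.
Proof.
move=> wg; rewrite (drift_stat (a := a) (H := fun j => j%:R)) //; last first.
  by move=> t j; rewrite -natr1; ring.
congr (_ + _); rewrite -[RHS](sum_indicator pi a).
by apply: eq_bigr => b _; rewrite mulr1 mulrC eq_sym.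
Qed.

Lemma drift_type_count a g : wf_network g ->
  drift pi kappa g0 (type_count a) g = pi a.
Proof.
move=> wg; rewrite (drift_stat (a := a) (H := fun j => 0)) //; last first.
  by move=> t j; rewrite subrr !mulr0.
rewrite (eq_stat (F' := fun t j => 0 * 0)); last by move=> t j; rewrite !mulr0.
rewrite statZ mul0r mulr0 addr0 -[RHS](sum_indicator pi a).
by apply: eq_bigr => b _; rewrite mulrC eq_sym.
Qed.

Lemma drift_degree_count a k g : wf_network g ->
  drift pi kappa g0 (degree_count a k) g =
  pi a * (k == 1%N)%:R +
  attach_rate a g * (k.-1%:R * degree_count a k.-1 g - k%:R * degree_count a k g).
Proof.
move=> wg; rewrite (drift_stat (a := a)
  (H := fun j => k.-1%:R * (j == k.-1)%:R + (- k%:R) * (j == k)%:R)) //; last first.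
  move=> t j; rewrite -mulrBr mulrCA; congr (_ * _).
  rewrite mulrBr mulNr; congr (_ - _); last by case: eqP => [->|_]; rewrite ?mulr0.
  (* For [k = 0] no vertex enters the class, and [k.-1 = 0] makes the corresponding coefficient
     vanish. *)
  case: k => [|k] /=; first by rewrite !mulr0 mul0r.
  by rewrite eqSS; case: eqP => [->|_]; rewrite ?mulr0.
congr (_ + _ * _).
  rewrite -[in RHS](sum_indicator pi a) mulr_suml; apply: eq_bigr => b _.
  by rewrite mulrA [_ * pi b]mulrC (eq_sym a) (eq_sym k).
rewrite -mulNr -!statZ -statD; apply: eq_stat => t j; ring.
Qed.

(** * Edge counts between types *)

Lemma vtype_edge_attach g v b a : wf_network g ->
  {in nedges g, forall e, (vtype (attach g v b) e.1 == a) = (vtype g e.1 == a) /\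
    (vtype (attach g v b) e.2 == a) = (vtype g e.2 == a)}.
Proof.
move=> [_ /allP eg _] e /eg /andP[e1 e2].
by rewrite !vtype_attach.
Qed.

Lemma nedge_attach g v b a a' : wf_network g -> (v < gorder g)%N ->
  nedge (attach g v b) a a' = (nedge g a a' +
    (((vtype g v == a) && (b == a')) || ((vtype g v == a') && (b == a))))%N.
Proof.
move=> wg vg; rewrite /nedge /= -cats1 count_cat /= addn0.
rewrite vtype_attach // vtype_attach_new; congr (_ + _)%N.
apply: eq_in_count => e eg.
have [-> ->] := vtype_edge_attach v b a wg eg.
by have [-> ->] := vtype_edge_attach v b a' wg eg.
Qed.

Definition edge_count a a' g : R := (nedge g a a')%:R.

Lemma edge_count_attach g v b a a' : wf_network g -> (v < gorder g)%N ->
  edge_count a a' (attach g v b) - edge_count a a' g =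
  (((vtype g v == a) && (b == a')) || ((vtype g v == a') && (b == a)))%:R.
Proof.
by move=> wg vg; rewrite /edge_count nedge_attach // natrD addrC addKr.
Qed.

(** Separate from distinct types: there the two orientations of an edge are disjoint events whose
    rates add, here they coincide and count once. *)
Lemma drift_edge_count_diag a g : wf_network g ->
  drift pi kappa g0 (edge_count a a) g =
  pi a * kappa a a * (type_degree a g / attractivity a g).
Proof.
move=> wg; rewrite (driftE (Psi := fun b t j => (a == b)%:R * (t == a)%:R)).
  rewrite -(sum_indicator (fun b =>
    pi b * kappa a b * (type_degree a g / attractivity b g))).
  apply: eq_bigr => b _; rewrite (eq_stat (F' := fun t j =>
    (a == b)%:R * kappa a b * ((t == a)%:R * j%:R))).
    by rewrite statZ -/(type_degree a); ring.
  move=> t j.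
  transitivity ((a == b)%:R * j%:R * (kappa t b * (t == a)%:R)); first by ring.
  rewrite (_ : kappa t b * (t == a)%:R = kappa a b * (t == a)%:R); first by ring.
  by case: eqP => [->|_]; rewrite ?mulr0.
move=> v b vg; by rewrite edge_count_attach // orbb -natrM mulnb andbC (eq_sym a).
Qed.

Lemma drift_edge_count a a' g : wf_network g -> a != a' ->
  drift pi kappa g0 (edge_count a a') g =
  pi a' * kappa a a' * (type_degree a g / attractivity a' g) +
  pi a * kappa a' a * (type_degree a' g / attractivity a g).
Proof.
move=> wg aa'; rewrite (driftE (Psi := fun b t j =>
  (a' == b)%:R * (t == a)%:R + (a == b)%:R * (t == a')%:R)).
  rewrite -(sum_indicator (fun b =>
    pi b * kappa a b * (type_degree a g / attractivity b g)) a').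
  rewrite -(sum_indicator (fun b =>
    pi b * kappa a' b * (type_degree a' g / attractivity b g)) a).
  rewrite -big_split; apply: eq_bigr => b _ /=; rewrite (eq_stat (F' := fun t j =>
    (a' == b)%:R * kappa a b * ((t == a)%:R * j%:R) +
    (a == b)%:R * kappa a' b * ((t == a')%:R * j%:R))).
    by rewrite statD !statZ -/(type_degree a) -/(type_degree a'); ring.
  move=> t j.
  have e c : kappa t b * (t == c)%:R = kappa c b * (t == c)%:R.
    by case: eqP => [->|_]; rewrite ?mulr0.
  transitivity ((a' == b)%:R * j%:R * (kappa t b * (t == a)%:R) +
    (a == b)%:R * j%:R * (kappa t b * (t == a')%:R)); first by ring.
  by rewrite !e; ring.
move=> v b vg; rewrite edge_count_attach // (eq_sym a') (eq_sym a).
have [->|_] := eqVneq (vtype g v) a.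
  by rewrite (negbTE aa') /= orbF mulr1 mulr0 addr0.
by rewrite mulr0 add0r /=; case: (_ == a'); rewrite ?mulr1 ?mulr0.
Qed.

End NetworkStatistics.

(** * Convergence of the degree shares *)

Lemma finite_pos_lower_bound (R : realFieldType) (I : finType) (F : I -> R) :
  (forall i, 0 < F i) -> exists2 c : R, 0 < c & forall i, c <= F i.
Proof.
move=> F_gt0; pose B := 1 + \sum_i (F i)^-1.
have S_ge0 : 0 <= \sum_i (F i)^-1 by apply: sumr_ge0 => i _; rewrite invr_ge0 ltW.
have B_gt0 : 0 < B by rewrite /B; lra.
exists B^-1 => [|i]; first by rewrite invr_gt0.
rewrite -[leRHS]invrK lef_pV2 ?posrE ?invr_gt0 // /B (bigD1 i) //=.
have : 0 <= \sum_(j | j != i) (F j)^-1 by apply: sumr_ge0 => j _; rewrite invr_ge0 ltW.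
lra.
Qed.

(** Combined with [ln1D_ge], this bounds [ln (1 + x)] below to second order. *)
Lemma frac1D_ge (R : realFieldType) (x : R) : `|x| <= 2^-1 -> x - 2 * x ^+ 2 <= x / (1 + x).
Proof.
rewrite ler_norml => /andP[x1 x2].
have h : 0 < 1 + x by lra.
rewrite ler_pdivlMr // -subr_ge0.
have -> : x - (x - 2 * x ^+ 2) * (1 + x) = x ^+ 2 * (1 + 2 * x) by ring.
by rewrite mulr_ge0 ?sqr_ge0 //; lra.
Qed.

(** Replaces a vanishing derivative: dividing by small [t] of either sign bounds [L] from both
    sides. *)
Lemma quadratic_perturbation_eq0 (R : realFieldType) (L K t0 : R) : 0 < t0 -> 0 <= K ->
  (forall t, `|t| <= t0 -> t * L <= t ^+ 2 * K) -> L = 0.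
Proof.
move=> t0_gt0 K_ge0 h.
have key (x : R) : (forall t, 0 < t -> t <= t0 -> t * x <= t ^+ 2 * K) -> x <= 0.
  move=> hx; apply/ler_addgt0Pr => /= e e_gt0; rewrite add0r.
  pose t := Num.min t0 (e / (K + 1)).
  have K1 : 0 < K + 1 by lra.
  have t_gt0 : 0 < t by rewrite lt_min t0_gt0 divr_gt0.
  have := hx t t_gt0; rewrite ge_min lexx expr2 -mulrA ler_pM2l // => /(_ isT).
  move=> /le_trans; apply; apply: le_trans (_ : e / (K + 1) * (K + 1) <= _).
    apply: ler_pM => //; [exact: ltW| |lra].
    by rewrite ge_min lexx orbT.
  by rewrite divfK // lt0r_neq0.
apply/eqP; rewrite eq_le; apply/andP; split.
  by apply: key => t t_gt0 tt0; apply: h; rewrite gtr0_norm.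
rewrite -oppr_le0; apply: key => t t_gt0 tt0.
by have := h (- t); rewrite normrN gtr0_norm // sqrrN mulrN mulNr; apply.
Qed.

Section FirstOrder.
Variables (R : realType) (m : nat).
Variables (pi : 'I_m.+1 -> R) (kappa : 'M[R]_m.+1) (eta : 'I_m.+1 -> R).
Implicit Types (y : 'I_m.+1 -> R) (a b j l : 'I_m.+1).

(** The denominator of [nu] at a general vector; [attractivity] is its value at the type degrees. *)
Definition attract y b : R := \sum_l kappa l b * y l.

Lemma attract_gt0 y b : (forall a b, 0 < kappa a b) -> (forall a, 0 <= y a) ->
  0 < \sum_a y a -> 0 < attract y b.
Proof.
move=> kappa_gt0 y_ge0 y_sum.
have [c c_gt0 c_le] := finite_pos_lower_bound (fun l => kappa_gt0 l b).
apply: lt_le_trans (_ : c * \sum_a y a <= _); first by rewrite mulr_gt0.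
by rewrite mulr_sumr; apply: ler_sum => l _; rewrite ler_wpM2r.
Qed.

Hypothesis hpi : is_pmf_on_types pi.
Hypothesis kappa_gt0 : forall a b, 0 < kappa a b.
Hypothesis heta : is_minimizer pi kappa eta.

Lemma attract_minimizer_gt0 b : 0 < attract eta b.
Proof.
have [[eta_gt0 eta1] _] := heta.
by apply: attract_gt0 => // [l|]; [exact: ltW|rewrite eta1].
Qed.

Lemma phi_gt0 a : (forall b, 0 < pi b) -> 0 < phi pi kappa eta a.
Proof.
move=> pi_gt0; apply: lt_le_trans (_ : phi2 pi kappa eta a a <= _).
  by rewrite /phi2 mulr_gt0 // divr_gt0 //; exact: attract_minimizer_gt0.
rewrite /phi (bigD1 a) //= lerDl; apply: sumr_ge0 => b _.
by rewrite ltW // mulr_gt0 // divr_gt0 //; exact: attract_minimizer_gt0.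
Qed.

(* Only the directions [delta_a - eta] are needed, together with the bound
   [ln (1 + h) >= h - 2 h ^ 2], so that nothing has to be differentiated. *)
Lemma first_order_condition a : pi a / eta a + phi pi kappa eta a = 2.
Proof.
have [[eta_gt0 eta1] eta_min] := heta.
have [pi_ge0 pi1] := hpi.
have z_gt0 := attract_minimizer_gt0.
(* [u] and [w] are the logarithmic derivatives of the coordinates and of [attract] at [eta], in the
   direction [delta_a - eta]. *)
pose u j := (j == a)%:R / eta j - 1.
pose w j := kappa a j / attract eta j - 1.
pose B := \sum_j (`|u j| + `|w j|).
have B_ge0 : 0 <= B by apply: sumr_ge0 => j _; rewrite addr_ge0.
have uB j : `|u j| <= B /\ `|w j| <= B.
  have : `|u j| + `|w j| <= B.
    rewrite /B (bigD1 j) //= lerDl; apply: sumr_ge0 => i _; exact: addr_ge0.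
  have := normr_ge0 (u j); have := normr_ge0 (w j).
  by split; lra.
(* For [|t|] up to this bound all [|t * u j|] and [|t * w j|] are at most [1 / 2], so the perturbed
   point stays in the open simplex for both signs of [t]. *)
have t0_gt0 : 0 < (2 * (B + 1))^-1 by rewrite invr_gt0; lra.
have L0 : \sum_j pi j * (u j + w j) = 0.
  apply: (@quadratic_perturbation_eq0 _ _ (\sum_j pi j * (2 * u j ^+ 2 + 2 * w j ^+ 2)) _ t0_gt0).
    by apply: sumr_ge0 => j _; rewrite mulr_ge0 // addr_ge0 // mulr_ge0 ?sqr_ge0.
  move=> t t_le.
  have small x : `|x| <= B -> `|t * x| <= 2^-1.
    move=> xB; rewrite normrM.
    apply: le_trans (ler_pM (normr_ge0 _) (normr_ge0 _) t_le xB) _.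
    rewrite mulrC ler_pdivrMr; lra.
  have pos x : `|x| <= B -> 0 < 1 + t * x.
    by move=> /small; rewrite ler_norml => /andP[]; lra.
  pose y j := eta j * (1 + t * u j).
  have yE j : y j = (1 - t) * eta j + t * (j == a)%:R.
    by rewrite /y /u; field; rewrite lt0r_neq0.
  have zyE j : attract y j = attract eta j * (1 + t * w j).
    transitivity ((1 - t) * attract eta j + t * kappa a j).
      rewrite /attract; under eq_bigr do rewrite yE mulrDr mulrCA.
      rewrite big_split /= -mulr_sumr; congr (_ + _).
      rewrite (bigD1 a) //= eqxx mulr1 mulrC big1 ?addr0 // => l /negbTE ->.
      by rewrite !mulr0.
    by rewrite /w; field; rewrite lt0r_neq0.
  have ysimplex : in_open_simplex y.
    split=> [j|]; first by rewrite mulr_gt0 // pos // (uB j).1.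
    under eq_bigr do rewrite yE.
    rewrite big_split /= -!mulr_sumr eta1 (bigD1 a) //= eqxx big1.
      by rewrite addr0 !mulr1 subrK.
    by move=> l /negbTE ->.
  have := eta_min y ysimplex; rewrite /V_pi.
  rewrite lerD2l lerN2 ler_pM2l ?invr_gt0 // -subr_ge0 -sumrB.
  have stepE j : pi j * (ln (eta j) + ln (\sum_k eta k * kappa k j)) -
      pi j * (ln (y j) + ln (\sum_k y k * kappa k j)) =
      - (pi j * (ln (1 + t * u j) + ln (1 + t * w j))).
    have sE v : \sum_k v k * kappa k j = attract v j.
      by apply: eq_bigr => l _; rewrite mulrC.
    rewrite !sE zyE /y !lnM ?posrE ?pos ?(uB j).1 ?(uB j).2 //; ring.
  under eq_bigr do rewrite stepE.
  rewrite sumrN oppr_ge0 => h.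
  rewrite -subr_le0 !mulr_sumr -sumrB; apply: le_trans h.
  apply: ler_sum => j _.
  have -> : t * (pi j * (u j + w j)) - t ^+ 2 * (pi j * (2 * u j ^+ 2 + 2 * w j ^+ 2)) =
    pi j * ((t * u j - 2 * (t * u j) ^+ 2) + (t * w j - 2 * (t * w j) ^+ 2)) by ring.
  rewrite ler_wpM2l //; apply: lerD.
    apply: le_trans (frac1D_ge (small _ (uB j).1)) _; apply: ln1D_ge.
    by have := pos _ (uB j).1; lra.
  apply: le_trans (frac1D_ge (small _ (uB j).2)) _; apply: ln1D_ge.
  by have := pos _ (uB j).2; lra.
have -> : phi pi kappa eta a = \sum_j pi j * (kappa a j / attract eta j).
  apply: eq_bigr => j _; rewrite /phi2 /nu /attract; ring.
have : \sum_j pi j * (u j + w j) =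
  pi a / eta a + \sum_j pi j * (kappa a j / attract eta j) - 2.
  transitivity (\sum_j (pi j * ((j == a)%:R / eta j) +
     pi j * (kappa a j / attract eta j) - 2 * pi j)).
    by apply: eq_bigr => j _; rewrite /u /w; ring.
  rewrite sumrB big_split /= -mulr_sumr pi1 mulr1; congr (_ + _ - _).
  rewrite (bigD1 a) //= eqxx mul1r big1 ?addr0 // => j /negbTE ->.
  by rewrite mul0r mulr0.
rewrite L0; lra.
Qed.

End FirstOrder.

Lemma cvg_fin_sum (R : realType) (I : Type) (r : seq I) (f : I -> nat -> R) (l : I -> R) :
  (forall i, f i n @[n --> \oo] --> l i) ->
  \sum_(i <- r) f i n @[n --> \oo] --> \sum_(i <- r) l i.
Proof.
move=> fl; elim: r => [|i r IHr].
  rewrite big_nil; under eq_fun do rewrite big_nil; exact: cvg_cst.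
rewrite big_cons; under eq_fun do rewrite big_cons; exact: cvgD.
Qed.

Lemma cvg_n_affine (R : realType) (s0 : R) : 0 < s0 ->
  n%:R / (s0 + 2 * n%:R) @[n --> \oo] --> (2^-1 : R).
Proof.
move=> s0_gt0.
have L : (s0 * n%:R^-1 + 2)^-1 @[n --> \oo] --> (s0 * 0 + 2)^-1.
  apply: cvgV; first by rewrite mulr0 add0r.
  apply: cvgD; last exact: cvg_cst.
  apply: cvgM; first exact: cvg_cst.
  apply/gtr0_cvgV0; last exact: cvgr_idn.
  by near=> n; rewrite ltr0n; near: n; exact: nbhs_infty_gt.
rewrite mulr0 add0r in L; apply: cvg_trans L; apply: near_eq_cvg; near=> n.
have n_gt0 : (0 : R) < n%:R by rewrite ltr0n; near: n; exact: nbhs_infty_gt.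
have : 0 < s0 + 2 * n%:R by lra.
by move=> h; field; rewrite !lt0r_neq0.
Unshelve. all: by end_near. Qed.

(** * Relative entropy along the dynamics of the shares *)

Section ShareConvergence.
Variables (R : realType) (m : nat).
Variables (pi : 'I_m.+1 -> R) (kappa : 'M[R]_m.+1) (eta : 'I_m.+1 -> R).
Implicit Types (y : 'I_m.+1 -> R) (a b l : 'I_m.+1) (n : nat).

(** Probability that the new edge lands on type [a]; it is homogeneous of degree [0], hence the same
    for degrees and for shares. *)
Definition flow y a : R := \sum_b pi b * kappa a b * (y a / attract kappa y b).

Lemma attractZ (c : R) y b : attract kappa (fun a => c * y a) b = c * attract kappa y b.
Proof. by rewrite /attract mulr_sumr; apply: eq_bigr => l _; rewrite mulrCA. Qed.

Lemma flowZ (c : R) y a : c != 0 -> flow (fun a => c * y a) a = flow y a.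
Proof.
move=> c0; apply: eq_bigr => b _; rewrite attractZ; congr (_ * _).
by rewrite invfM mulrACA divff // mul1r.
Qed.

(** Kullback-Leibler divergence averaged under [eta]; its gradient has the coordinates
    [- eta a / y a]. *)
Definition rel_entropy y : R := - \sum_a eta a * ln (y a / eta a).

Hypothesis hpi : is_pmf_on_types pi.
Hypothesis pi_gt0 : forall a, 0 < pi a.
Hypothesis kappa_gt0 : forall a b, 0 < kappa a b.
Hypothesis heta : is_minimizer pi kappa eta.

Let eta_gt0 a : 0 < eta a.
Proof. by have [[]] := heta. Qed.

Let eta1 : \sum_a eta a = 1.
Proof. by have [[]] := heta. Qed.

Section Simplex.
Variable y : 'I_m.+1 -> R.
Hypothesis hy : in_open_simplex y.

Let y_gt0 a : 0 < y a. Proof. by case: hy. Qed.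
Let y1 : \sum_a y a = 1. Proof. by case: hy. Qed.

Lemma rel_entropy_le_chi2 : rel_entropy y <= \sum_a (y a - eta a) ^+ 2 / y a.
Proof.
have -> : \sum_a (y a - eta a) ^+ 2 / y a = \sum_a eta a * (eta a / y a - 1).
  transitivity (\sum_a (eta a * (eta a / y a - 1) + (y a - eta a))).
    by apply: eq_bigr => a _; field; rewrite lt0r_neq0.
  by rewrite big_split /= sumrB y1 eta1 subrr addr0.
rewrite /rel_entropy -sumrN; apply: ler_sum => a _.
have q_gt0 : 0 < eta a / y a by rewrite divr_gt0.
rewrite -mulrN (ler_wpM2l (ltW (eta_gt0 a))) // -lnV ?posrE ?divr_gt0 // invf_div.
by have := @le_ln1Dx _ (eta a / y a - 1); rewrite subrKC; apply; lra.
Qed.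

(* Relative entropy dominates the squared Hellinger distance. *)
Lemma rel_entropy_ge_dist a : (y a - eta a) ^+ 2 <= 4 * rel_entropy y.
Proof.
have le1 (x : 'I_m.+1 -> R) : in_open_simplex x -> x a <= 1.
  move=> [x0 <-]; rewrite (bigD1 a) //= lerDl; apply: sumr_ge0 => b _; exact: ltW.
pose s b := (Num.sqrt (y b) - Num.sqrt (eta b)) ^+ 2.
have sE b : s b = y b + eta b - 2 * (Num.sqrt (y b) * Num.sqrt (eta b)).
  rewrite /s sqrrB (sqr_sqrtr (ltW (y_gt0 b))) (sqr_sqrtr (ltW (eta_gt0 b))).
  ring.
have hell : \sum_b s b <= rel_entropy y.
  have -> : \sum_b s b = \sum_b eta b * (2 * (1 - Num.sqrt (y b) / Num.sqrt (eta b))).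
    transitivity (\sum_b (eta b * (2 * (1 - Num.sqrt (y b) / Num.sqrt (eta b)))
       + (y b - eta b))).
      apply: eq_bigr => b _; rewrite sE.
      have se : Num.sqrt (eta b) != 0 by rewrite gt_eqF // sqrtr_gt0.
      have := sqr_sqrtr (ltW (eta_gt0 b)); move: (Num.sqrt (eta b)) se => e e0 <-.
      by field.
    by rewrite big_split /= sumrB y1 eta1 subrr addr0.
  rewrite /rel_entropy -sumrN; apply: ler_sum => b _.
  rewrite -[leRHS]mulrN (ler_wpM2l (ltW (eta_gt0 b))) //.
  have r_gt0 : 0 < Num.sqrt (y b) / Num.sqrt (eta b) by rewrite divr_gt0 ?sqrtr_gt0.
  have -> : y b / eta b = (Num.sqrt (y b) / Num.sqrt (eta b)) ^+ 2.
    by rewrite expr_div_n !sqr_sqrtr // ltW.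
  rewrite lnXn // -mulr_natl.
  have := @le_ln1Dx _ (Num.sqrt (y b) / Num.sqrt (eta b) - 1).
  by rewrite subrKC => /(_ ltac:(lra)); lra.
(* [y a - eta a] factors through the square roots, whose sum is at most [2]. *)
apply: le_trans (_ : 4 * s a <= _).
  have -> : (y a - eta a) ^+ 2 = (Num.sqrt (y a) + Num.sqrt (eta a)) ^+ 2 * s a.
    rewrite /s -exprMn -[in LHS](sqr_sqrtr (ltW (y_gt0 a))).
    by rewrite -[in LHS](sqr_sqrtr (ltW (eta_gt0 a))); congr (_ ^+ 2); ring.
  rewrite ler_wpM2r ?sqr_ge0 // (_ : 4 = 2 ^+ 2); last by ring.
  rewrite lerXn2r ?nnegrE ?addr_ge0 ?sqrtr_ge0 //.
  have := ler_wsqrtr (le1 y hy); have := ler_wsqrtr (le1 eta heta.1).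
  rewrite sqrtr1; lra.
rewrite ler_pM2l //; apply: le_trans hell.
by rewrite (bigD1 a) //= lerDl; apply: sumr_ge0 => b _; exact: sqr_ge0.
Qed.

(* By the first-order condition, [sum_a y a * (pi a / eta a + phi a) = 2];
   adding this identity to the drift of the relative entropy pairs each ratio
   with its inverse, and [2 - r - 1 / r <= 0]. *)
Lemma rel_entropy_dissipation :
  2 - \sum_a eta a / y a * (pi a + flow y a) <=
  - \sum_a pi a / eta a * ((y a - eta a) ^+ 2 / y a).
Proof.
have z_gt0 b : 0 < attract kappa y b.
  by apply: attract_gt0 => // [a|]; [exact: ltW|rewrite y1].
have ze_gt0 b : 0 < attract kappa eta b.
  by apply: attract_gt0 => // [a|]; [exact: ltW|rewrite eta1].
have [_ pi1] := hpi.
have flow_sum (x : 'I_m.+1 -> R) (G : 'I_m.+1 -> R) :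
    \sum_a x a * (\sum_b pi b * kappa a b * G b) = \sum_b pi b * (attract kappa x b * G b).
  under eq_bigr do rewrite mulr_sumr.
  rewrite exchange_big; apply: eq_bigr => b _ /=.
  rewrite /attract mulr_suml mulr_sumr; apply: eq_bigr => a _; ring.
have A1 : \sum_a eta a / y a * (pi a + flow y a) =
    \sum_a pi a * (eta a / y a) +
    \sum_b pi b * (attract kappa eta b * (attract kappa y b)^-1).
  rewrite -flow_sum -big_split /=; apply: eq_bigr => a _.
  rewrite mulrDr; congr (_ + _); first by ring.
  rewrite /flow !mulr_sumr; apply: eq_bigr => b _; field.
  by rewrite !lt0r_neq0.
have A2 : \sum_a pi a * (y a / eta a) +
    \sum_b pi b * (attract kappa y b * (attract kappa eta b)^-1) = 2.
  rewrite -flow_sum -big_split /=.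
  transitivity (\sum_a y a * 2); last by rewrite -mulr_suml y1 mul1r.
  apply: eq_bigr => a _.
  rewrite -(first_order_condition hpi kappa_gt0 heta a) mulrDr; congr (_ + _).
    by ring.
  congr (_ * _); apply: eq_bigr => b _; rewrite /phi2 /nu /attract; ring.
have B1 (r s : R) : 0 < r -> 0 < s -> 2 - r / s - s / r = - ((s - r) ^+ 2 / (r * s)).
  by move=> r0 s0; field; rewrite !lt0r_neq0.
have C1 : 2 - \sum_a eta a / y a * (pi a + flow y a) =
    \sum_a pi a * (2 - eta a / y a - y a / eta a) +
    \sum_b pi b * (2 - attract kappa eta b / attract kappa y b
                     - attract kappa y b / attract kappa eta b).
  rewrite A1.
  have e (u v : 'I_m.+1 -> R) : \sum_a pi a * (2 - u a - v a) =
      2 - \sum_a pi a * u a - \sum_a pi a * v a.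
    transitivity (\sum_a (2 * pi a - pi a * u a - pi a * v a)).
      by apply: eq_bigr => a _; ring.
    by rewrite !sumrB -mulr_sumr pi1 mulr1.
  rewrite !e; move: A2; lra.
rewrite C1 -[leRHS]addr0 -sumrN; apply: lerD.
  apply: ler_sum => a _; rewrite B1 // mulrN lerN2 le_eqVlt; apply/orP; left.
  by apply/eqP; field; rewrite !lt0r_neq0.
(* The terms formed by the ratios of [attract] are dissipative too and are dropped. *)
rewrite -oppr_ge0 -sumrN; apply: sumr_ge0 => b _.
rewrite B1 // mulrN opprK mulr_ge0 ?divr_ge0 ?sqr_ge0 //; apply: ltW => //.
exact: mulr_gt0.
Qed.

End Simplex.

Lemma flow_le1 y a : (forall a, 0 <= y a) -> 0 < \sum_a y a -> 0 <= flow y a <= 1.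
Proof.
move=> y_ge0 y_sum; have [_ pi1] := hpi.
have z_gt0 b : 0 < attract kappa y b by apply: attract_gt0.
apply/andP; split.
  apply: sumr_ge0 => b _; rewrite mulr_ge0 ?divr_ge0 //.
    by rewrite ltW // mulr_gt0.
  by rewrite ltW.
rewrite -[leRHS]pi1; apply: ler_sum => b _.
rewrite -mulrA (ler_piMr (ltW (pi_gt0 b))) // mulrA ler_pdivrMr // mul1r.
rewrite /attract (bigD1 a) //= lerDl.
by apply: sumr_ge0 => l _; rewrite mulr_ge0 // ltW.
Qed.

Lemma sum_flow y : (forall a, 0 <= y a) -> 0 < \sum_a y a -> \sum_a flow y a = 1.
Proof.
move=> y_ge0 y_sum; have [_ pi1] := hpi.
have z_gt0 b : 0 < attract kappa y b by apply: attract_gt0.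
rewrite exchange_big /= -[RHS]pi1; apply: eq_bigr => b _.
transitivity (pi b * (attract kappa y b / attract kappa y b)); last first.
  by rewrite divff ?mulr1 // gt_eqF.
rewrite {2}/attract mulr_suml mulr_sumr; apply: eq_bigr => a _; ring.
Qed.

(** On the simplex [attract] is at least any lower bound [c > 0] of the [kappa l b], so the ratio is
    Lipschitz up to the boundary. *)
Lemma cvg_share_ratio (x y : nat -> 'I_m.+1 -> R) a b :
  (forall n a, 0 <= x n a) -> (forall n a, 0 <= y n a) ->
  (forall n, \sum_a x n a = 1) -> (\forall n \near \oo, \sum_a y n a = 1) ->
  (forall a, x n a - y n a @[n --> \oo] --> 0) ->
  x n a / attract kappa (x n) b - y n a / attract kappa (y n) b @[n --> \oo] --> 0.
Proof.
move=> x_ge0 y_ge0 x1 y1 xy.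
have [c c_gt0 c_le] := finite_pos_lower_bound (fun l => kappa_gt0 l b).
have attract_ge (v : 'I_m.+1 -> R) : (forall a, 0 <= v a) -> \sum_a v a = 1 ->
    c <= attract kappa v b.
  move=> v_ge0 v1; rewrite -[leLHS]mulr1 -v1 mulr_sumr.
  by apply: ler_sum => l _; rewrite ler_wpM2r.
have zxy : attract kappa (x n) b - attract kappa (y n) b @[n --> \oo] --> 0.
  have -> : (fun n => attract kappa (x n) b - attract kappa (y n) b) =
      (fun n => \sum_l kappa l b * (x n l - y n l)).
    apply/funext => n; rewrite /attract -sumrB; apply: eq_bigr => l _; ring.
  rewrite [X in _ --> X](_ : 0 = \sum_l kappa l b * 0 :> R); last first.
    by rewrite big1 // => l _; rewrite mulr0.
  by apply: cvg_fin_sum => l; apply: cvgM; [exact: cvg_cst|exact: xy].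
apply: norm_cvg0.
apply: (@squeeze_cvgr _ _ _ _ (fun=> 0)
  (fun n => `|x n a - y n a| / c + `|attract kappa (x n) b - attract kappa (y n) b| / c ^+ 2)).
- near=> n; rewrite normr_ge0 /=.
  have y1n : \sum_a y n a = 1 by near: n.
  have zx := attract_ge _ (x_ge0 n) (x1 n).
  have zy := attract_ge _ (y_ge0 n) y1n.
  have zx0 := lt_le_trans c_gt0 zx; have zy0 := lt_le_trans c_gt0 zy.
  have ya1 : `|y n a| <= 1.
    rewrite ger0_norm // -y1n (bigD1 a) //= lerDl.
    by apply: sumr_ge0 => l _.
  have -> : x n a / attract kappa (x n) b - y n a / attract kappa (y n) b =
     (x n a - y n a) / attract kappa (x n) b -
     y n a * ((attract kappa (x n) b - attract kappa (y n) b) /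
       (attract kappa (x n) b * attract kappa (y n) b)).
    by field; rewrite !lt0r_neq0.
  apply: le_trans (ler_normB _ _) _; apply: lerD.
    rewrite normrM [`|_^-1|]gtr0_norm ?invr_gt0 // ler_wpM2l //.
    by rewrite lef_pV2 ?posrE.
  rewrite !normrM -[leRHS]mul1r; apply: ler_pM => //.
  rewrite [`|_^-1|]gtr0_norm ?invr_gt0 ?mulr_gt0 // ler_wpM2l //.
  rewrite lef_pV2 ?posrE ?mulr_gt0 ?exprn_gt0 // expr2.
  by apply: ler_pM => //; exact: ltW.
- exact: cvg_cst.
- rewrite [X in _ --> X](_ : 0 = `|0 : R| / c + `|0 : R| / c ^+ 2 :> R); last first.
    by rewrite normr0 !mul0r addr0.
  apply: cvgD.
    apply: cvgM; last exact: cvg_cst.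
    by apply: cvg_norm; exact: xy.
  apply: cvgM; last exact: cvg_cst.
  by apply: cvg_norm; exact: zxy.
Unshelve. all: by end_near. Qed.

Lemma cvg_flow (x y : nat -> 'I_m.+1 -> R) a :
  (forall n a, 0 <= x n a) -> (forall n a, 0 <= y n a) ->
  (forall n, \sum_a x n a = 1) -> (\forall n \near \oo, \sum_a y n a = 1) ->
  (forall a, x n a - y n a @[n --> \oo] --> 0) ->
  flow (x n) a - flow (y n) a @[n --> \oo] --> 0.
Proof.
move=> x_ge0 y_ge0 x1 y1 xy.
have -> : (fun n => flow (x n) a - flow (y n) a) = (fun n => \sum_b pi b * kappa a b *
    (x n a / attract kappa (x n) b - y n a / attract kappa (y n) b)).
  by apply/funext => n; rewrite /flow -sumrB; apply: eq_bigr => b _; rewrite mulrBr.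
rewrite [X in _ --> X](_ : 0 = \sum_b pi b * kappa a b * 0 :> R); last first.
  by rewrite big1 // => b _; rewrite mulr0.
apply: cvg_fin_sum => b; apply: cvgM; first exact: cvg_cst.
exact: cvg_share_ratio.
Qed.

(** One discrete step of the entropy: the growth of the total contributes [ln (1 + 2 / S) <= 2 / S],
    and each [ln (1 + G a / Y a)] is bounded below to second order using [G a <= 2]. *)
Lemma rel_entropy_step (Y G : 'I_m.+1 -> R) (S : R) : 0 < S ->
  (forall a, 0 < Y a) -> (forall a, 0 <= G a <= 2) ->
  rel_entropy (fun a => (Y a + G a) / (S + 2)) <=
  rel_entropy (fun a => Y a / S) +
  S^-1 * (2 - \sum_a eta a / (Y a / S) * G a) + \sum_a eta a * (2 / Y a) ^+ 2.
Proof.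
move=> S_gt0 Y_gt0 G_bnd.
suff h a : - (eta a * ln ((Y a + G a) / (S + 2) / eta a)) <=
    - (eta a * ln (Y a / S / eta a)) +
    S^-1 * (2 * eta a - eta a / (Y a / S) * G a) + eta a * (2 / Y a) ^+ 2.
  have := ler_sum (index_enum _) (fun a (_ : true) => h a).
  by rewrite !big_split /= !sumrN -mulr_sumr sumrB -mulr_sumr eta1 mulr1.
have /andP[G0 G2] := G_bnd a; have Ya := Y_gt0 a; have ea := eta_gt0 a.
have hG : 0 < 1 + G a / Y a by rewrite ltr_wpDr // divr_ge0 // ltW.
have hS : 0 < 1 + 2 / S by rewrite addr_gt0 // divr_gt0.
have -> : (Y a + G a) / (S + 2) / eta a =
    Y a / S / eta a * ((1 + G a / Y a) / (1 + 2 / S)).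
  by field; rewrite !lt0r_neq0 // addr_gt0.
rewrite lnM ?posrE ?divr_gt0 //.
rewrite [ln ((1 + _) / _)]ln_div ?posrE //.
have h1 : ln (1 + 2 / S) <= 2 / S.
  by apply: le_ln1Dx; apply: lt_trans (_ : 0 < _); [lra|rewrite divr_gt0].
have h2 : G a / Y a - (2 / Y a) ^+ 2 <= ln (1 + G a / Y a).
  apply: le_trans (ln1D_ge _); last first.
    by apply: lt_le_trans (_ : 0 <= _); [lra|rewrite divr_ge0 // ltW].
  rewrite ler_pdivlMr //.
  have g0 : 0 <= G a / Y a by rewrite divr_ge0 // ltW.
  have g2 : (G a / Y a) ^+ 2 <= (2 / Y a) ^+ 2.
    have y0 : 0 <= 2 / Y a by rewrite divr_ge0 // ltW.
    by rewrite lerXn2r ?nnegrE // ler_wpM2r // invr_ge0 ltW.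
  have := sqr_ge0 (2 / Y a); move: g0 g2.
  move: (G a / Y a) ((2 / Y a) ^+ 2) => g w g0 g2 w0.
  have : 0 <= w * g by rewrite mulr_ge0.
  have : (g - w) * (1 + g) = g - w + g ^+ 2 - w * g by ring.
  lra.
rewrite [S^-1 * (_ - _)]mulrBr.
have -> : S^-1 * (eta a / (Y a / S) * G a) = eta a * (G a / Y a).
  by field; rewrite !lt0r_neq0.
have -> : S^-1 * (2 * eta a) = eta a * (2 / S) by ring.
have := ler_wpM2l (ltW ea) h1; have := ler_wpM2l (ltW ea) h2.
lra.
Qed.

Section ShareSequence.
Variables (X : nat -> 'I_m.+1 -> R) (s0 : R).
Hypothesis s0_gt0 : 0 < s0.
Hypothesis X_ge0 : forall n a, 0 <= X n a.
Hypothesis X_sum : forall n, \sum_a X n a = s0 + 2 * n%:R.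
Hypothesis X_noise : forall a,
  (X n a - X 0 a - \sum_(i < n) (pi a + flow (X i) a)) / n%:R @[n --> \oo] --> (0 : R).

Lemma cvg_share a : X n a / (s0 + 2 * n%:R) @[n --> \oo] --> eta a.
Proof.
have s0' := s0_gt0; have [_ pi1] := hpi.
pose S n : R := s0 + 2 * n%:R.
have S_gt0 n : 0 < S n by rewrite /S ltr_wpDr // mulr_ge0.
pose G n a := pi a + flow (X n) a.
have Xs_gt0 n : 0 < \sum_a X n a by rewrite X_sum; exact: S_gt0.
have pi_le1 b : pi b <= 1.
  by rewrite -pi1 (bigD1 b) //= lerDl; apply: sumr_ge0 => l _; exact: ltW.
have G_bnd n b : pi b <= G n b /\ 0 <= G n b <= 2.
  have /andP[f0 f1] := flow_le1 b (X_ge0 n) (Xs_gt0 n).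
  have := pi_gt0 b; have := pi_le1 b; rewrite /G => p1 p0.
  by split; [|apply/andP; split]; lra.
(* [Y] has the drift of [X] but no noise, so the noise only enters through the
   vanishing difference of the shares [x] and [y]. *)
pose Y n a := X 0 a + \sum_(i < n) G i a.
have YS n b : Y n.+1 b = Y n b + G n b by rewrite /Y big_ord_recr addrA.
have Y_ge n b : pi b * n%:R <= Y n b.
  elim: n => [|n IHn]; first by rewrite mulr0 /Y big_ord0 addr0.
  by rewrite YS -natr1 mulrDr mulr1 lerD // (G_bnd n b).1.
have Y_sum n : \sum_b Y n b = S n.
  elim: n => [|n IHn].
    by rewrite -[RHS]X_sum; apply: eq_bigr => b _; rewrite /Y big_ord0 addr0.
  under eq_bigr do rewrite YS.
  by rewrite big_split /= IHn /G big_split /= pi1 sum_flow // /S -natr1; ring.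
pose x n a := X n a / S n; pose y n a := Y n a / S n.
have Y_ge0 n b : 0 <= Y n b by apply: le_trans (Y_ge n b); apply: mulr_ge0 => //; exact: ltW.
have x_ge0 n b : 0 <= x n b by rewrite divr_ge0 // ltW.
have y_ge0 n b : 0 <= y n b by rewrite divr_ge0 // ltW.
have x1 n : \sum_b x n b = 1 by rewrite /x -mulr_suml X_sum -/(S n) divff // gt_eqF.
have y1 n : \sum_b y n b = 1 by rewrite /y -mulr_suml Y_sum divff // gt_eqF.
have xy b : x n b - y n b @[n --> \oo] --> 0.
  have L : (X n b - X 0 b - \sum_(i < n) (pi b + flow (X i) b)) / n%:R *
      (n%:R / (s0 + 2 * n%:R)) @[n --> \oo] --> (0 * 2^-1 : R).
    by apply: cvgM; [exact: X_noise|exact: cvg_n_affine].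
  rewrite mul0r in L; apply: cvg_trans L; apply: near_eq_cvg; near=> n.
  have n_gt0 : (0 : R) < n%:R by rewrite ltr0n; near: n; exact: nbhs_infty_gt.
  have h := S_gt0 n; rewrite /= /x /y /Y -/(S n).
  by field; rewrite !lt0r_neq0.
pose D n b := flow (X n) b - flow (y n) b.
have D0 b : D n b @[n --> \oo] --> 0.
  have -> : D ^~ b = (fun n => flow (x n) b - flow (y n) b).
    apply/funext => n; rewrite /D; congr (_ - _).
    have -> : x n = (fun a => (S n)^-1 * X n a).
      by apply/funext => c; rewrite mulrC.
    by rewrite flowZ // invr_eq0 gt_eqF.
  by apply: cvg_flow => //; exact: nearW.
(* The weights [pi b / eta b] of the dissipation are at least [c], which becomes the decay rate of
   the entropy. *)
have [c c_gt0 c_le] := finite_pos_lower_bound (fun b => divr_gt0 (pi_gt0 b) (eta_gt0 b)).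
pose W n := rel_entropy (y n).
(* At time [0] a type may be absent, so positivity starts at time [1]. *)
have ysimplex n : (0 < n)%N -> in_open_simplex (y n).
  move=> n_gt0; split => // b; rewrite divr_gt0 // (lt_le_trans _ (Y_ge n b)) //.
  by rewrite mulr_gt0 // ltr0n.
have W_ge n b : (0 < n)%N -> (y n b - eta b) ^+ 2 <= 4 * W n.
  by move=> n_gt0; exact: rel_entropy_ge_dist (ysimplex n n_gt0) b.
have W_ge0 n : (0 < n)%N -> 0 <= W n.
  move=> n_gt0; have := le_trans (sqr_ge0 _) (W_ge n ord0 n_gt0).
  by rewrite pmulr_rge0.
(* An upper bound for [1 / y n b] when [n >= 1], from [S n <= (s0 + 2) * n] and
   [Y n b >= pi b * n]. *)
pose B b := (s0 + 2) / pi b.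
have B_gt0 b : 0 < B b by rewrite divr_gt0 //; lra.
(* The first sum pays for evaluating the flow at the noisy share; the second is the quadratic
   remainder of [rel_entropy_step]. *)
pose e n := \sum_b eta b * B b * `|D n b| +
  (\sum_b eta b * (4 * B b / pi b)) * n%:R^-1.
have e_ge0 n : 0 <= e n.
  rewrite addr_ge0 ?mulr_ge0 ?invr_ge0 //; apply: sumr_ge0 => b _.
    by apply: mulr_ge0 => //; apply: mulr_ge0; exact: ltW.
  apply: mulr_ge0; first exact: ltW.
  apply: divr_ge0; last exact: ltW.
  by apply: mulr_ge0 => //; exact: ltW.
have W_step n : (0 < n)%N -> W n.+1 <= W n - (S n)^-1 * (c * W n) + (S n)^-1 * e n.
  move=> n_gt0.
  have n_gt0R : (0 : R) < n%:R by rewrite ltr0n.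
  have Sn := S_gt0 n; have [yn_gt0 _] := ysimplex n n_gt0.
  have Yn_gt0 b : 0 < Y n b.
    by rewrite (lt_le_trans _ (Y_ge n b)) // mulr_gt0.
  have S_le : S n <= (s0 + 2) * n%:R.
    have : 1 <= n%:R :> R by rewrite ler1n.
    by rewrite /S => n1; have := ler_wpM2l (ltW s0') n1; lra.
  have inv_y b : (y n b)^-1 <= B b.
    rewrite /y invf_div /B ler_pdivrMr //.
    apply: le_trans S_le _; have := ler_wpM2l (ltW (B_gt0 b)) (Y_ge n b).
    by rewrite /B mulrA divfK // gt_eqF.
  have dis := rel_entropy_dissipation (ysimplex n n_gt0).
  have chi := rel_entropy_le_chi2 (ysimplex n n_gt0).
  have step := rel_entropy_step Sn Yn_gt0 (fun b => (G_bnd n b).2).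
  have -> : W n.+1 = rel_entropy (fun b => (Y n b + G n b) / (S n + 2)).
    rewrite /W /y; congr rel_entropy; apply/funext => b.
    by rewrite YS /S -natr1; congr (_ / _); ring.
  apply: le_trans step _; rewrite -/(y n) -/(W n).
  have GE : \sum_b eta b / (Y n b / S n) * G n b =
      \sum_b eta b / y n b * (pi b + flow (y n) b) + \sum_b eta b / y n b * D n b.
    by rewrite -big_split /=; apply: eq_bigr => b _; rewrite /G /D /y; ring.
  have h1 : 2 - \sum_b eta b / (Y n b / S n) * G n b <=
      - (c * W n) + \sum_b eta b * B b * `|D n b|.
    rewrite GE opprD addrA; apply: lerD.
      apply: le_trans dis _; rewrite lerN2.
      apply: le_trans (ler_wpM2l (ltW c_gt0) chi) _.
      rewrite mulr_sumr; apply: ler_sum => b _.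
      by rewrite ler_wpM2r // divr_ge0 ?sqr_ge0 // ltW.
    rewrite -sumrN; apply: ler_sum => b _.
    apply: le_trans (ler_norm _) _; rewrite normrN normrM ler_wpM2r //.
    rewrite gtr0_norm ?divr_gt0 // ler_wpM2l //; exact: ltW.
  have h2 : \sum_b eta b * (2 / Y n b) ^+ 2 <=
      (S n)^-1 * ((\sum_b eta b * (4 * B b / pi b)) * n%:R^-1).
    rewrite mulr_suml mulr_sumr; apply: ler_sum => b _.
    rewrite [leRHS](_ : _ = eta b * ((S n)^-1 * (4 * B b / (pi b * n%:R)))); last first.
      by field; rewrite !lt0r_neq0.
    rewrite (ler_wpM2l (ltW (eta_gt0 b))) //.
    have -> : (2 / Y n b) ^+ 2 = (S n)^-1 * (4 * (y n b)^-1 * (Y n b)^-1).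
      by rewrite /y; field; have := Yn_gt0 b => /lt0r_neq0 ->; rewrite lt0r_neq0.
    apply: ler_wpM2l; first by rewrite invr_ge0 ltW.
    apply: ler_pM; rewrite ?mulr_ge0 ?invr_ge0 //; first by rewrite ler_pM2l.
    by rewrite lef_pV2 ?posrE // mulr_gt0.
  have iS : 0 <= (S n)^-1 by rewrite invr_ge0 ltW.
  have := ler_wpM2l iS h1; rewrite /e !mulrDr mulrN; move: h2; lra.
have e0 : e n @[n --> \oo] --> 0.
  rewrite [X in _ --> X](_ : 0 = \sum_b eta b * B b * `|0 : R| +
     (\sum_b eta b * (4 * B b / pi b)) * 0); last first.
    by rewrite mulr0 addr0 big1 // => b _; rewrite normr0 mulr0.
  apply: cvgD.
    apply: cvg_fin_sum => b; apply: cvgM; first exact: cvg_cst.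
    by apply: cvg_norm; exact: D0.
  apply: cvgM; first exact: cvg_cst.
  apply/gtr0_cvgV0; last exact: cvgr_idn.
  by near=> n; rewrite ltr0n; near: n; exact: nbhs_infty_gt.
have W0 : W n @[n --> \oo] --> 0.
  (* Passing from [1 / S n] to [1 / n.+1]: [S n <= (s0 + 2) * n.+1] for the contraction,
     [n.+1 <= (s0^-1 + 1) * S n] for the error. *)
  apply: (@robbins_monro_cvg0 _ (c / (s0 + 2)) _ (fun n => e n * (s0^-1 + 1))).
  - by rewrite divr_gt0 //; lra.
  - by near=> n; apply: W_ge0; near: n; exact: nbhs_infty_gt.
  - near=> n.
    have n_gt0 : (0 < n)%N by near: n; exact: nbhs_infty_gt.
    have Sn := S_gt0 n; have Wn := W_ge0 n n_gt0; have en := e_ge0 n.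
    have n1 : (0 : R) < n.+1%:R by rewrite ltr0n.
    apply: le_trans (W_step n n_gt0) _.
    have iS1 : ((s0 + 2) * n.+1%:R)^-1 <= (S n)^-1.
      rewrite lef_pV2 ?posrE ?mulr_gt0 //; last by lra.
      rewrite /S -(natr1 n) mulrDr mulr1.
      have : 0 <= s0 * n%:R by rewrite mulr_ge0 // ltW.
      lra.
    have iS2 : (S n)^-1 <= (s0^-1 + 1) / n.+1%:R.
      rewrite ler_pdivlMr // mulrC ler_pdivrMr //.
      have -> : (s0^-1 + 1) * S n = 1 + 2 * n%:R * s0^-1 + S n.
        by rewrite /S; field; rewrite lt0r_neq0.
      have : 0 <= 2 * n%:R * s0^-1 by rewrite !mulr_ge0 // invr_ge0 ltW.
      have : 0 <= n%:R :> R by [].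
      by rewrite -(natr1 n) /S; lra.
    have cW : 0 <= c * W n by rewrite mulr_ge0 // ltW.
    have -> : (1 - c / (s0 + 2) / n.+1%:R) * W n =
        W n - ((s0 + 2) * n.+1%:R)^-1 * (c * W n).
      by field; rewrite !lt0r_neq0 //; lra.
    have -> : e n * (s0^-1 + 1) / n.+1%:R = (s0^-1 + 1) / n.+1%:R * e n by ring.
    by apply: lerD; [rewrite lerD2l lerN2|]; apply: ler_wpM2r.
  - rewrite -[X in _ --> X](mul0r (s0^-1 + 1)).
    by apply: cvgM => //; exact: cvg_cst.
have ye : y n a - eta a @[n --> \oo] --> 0.
  apply/cvgr0Pnorm_le => /= r r_gt0.
  have r2 : 0 < r ^+ 2 / 4 by rewrite divr_gt0 // exprn_gt0.
  have /cvgr0Pnorm_le/(_ _ r2) := W0; apply: filter_app; near=> n.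
  move=> /ler_normlW Wr.
  have n_gt0 : (0 < n)%N by near: n; exact: nbhs_infty_gt.
  have := W_ge n a n_gt0; rewrite -real_normK ?num_real // => h.
  rewrite -(@ler_pXn2r _ 2) ?nnegrE //; last exact: ltW.
  by apply: le_trans h _; move: Wr; rewrite ler_pdivlMr //; lra.
have L : (x n a - y n a) + (y n a - eta a) + eta a @[n --> \oo] --> (0 + 0 + eta a : R).
  by apply: cvgD; [apply: cvgD; [exact: xy|exact: ye]|exact: cvg_cst].
rewrite addr0 add0r in L; apply: cvg_trans L; apply: near_eq_cvg; near=> n.
by rewrite /x /=; ring.
Unshelve. all: by end_near. Qed.

End ShareSequence.
End ShareConvergence.

(** * Limits of the statistics *)

Section StatisticsCounts.
Variables (R : realType) (m : nat) (g0 : network m).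
Implicit Types (g : network m) (a b : 'I_m.+1) (k : nat).

Lemma nvertE g a : (nvert g a)%:R = type_count R g0 a g :> R.
Proof.
rewrite /nvert -sum1_count natr_sum (big_nth ord0) big_mkord.
rewrite big_mkcond /=; apply: eq_bigr => u _.
by rewrite -/(vtype g u); case: (_ == a).
Qed.

Lemma degree_countE g a k :
  (count (fun v => (vtype g v == a) && (deg g0 g v == k)) (vertices g))%:R =
  degree_count R g0 a k g :> R.
Proof.
rewrite -sum1_count natr_sum big_mkcond /= sum_vertices.
by apply: eq_bigr => u _; case: (_ == a); case: (_ == k); rewrite ?mulr1 ?mulr0.
Qed.

Lemma emp_degE g a k :
  emp_deg R g0 g a k = degree_count R g0 a k g / type_count R g0 a g.
Proof. by rewrite /emp_deg degree_countE nvertE. Qed.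

Lemma bin2R n : 'C(n, 2)%:R = n%:R * (n%:R - 1) / 2 :> R.
Proof.
case: n => [|n]; first by rewrite mul0r mul0r.
have h : ('C(n.+1, 2) * 2 = n.+1 * n)%N.
  by rewrite bin2 -[RHS](odd_double_half (n.+1 * n)) oddM /= andNb add0n muln2.
apply: (mulIf (x := 2)) => //; rewrite divfK // -natrM h natrM -(natr1 n); ring.
Qed.

Lemma stat_norm_le (F : 'I_m.+1 -> nat -> R) g : (forall t j, `|F t j| <= 1) ->
  `|stat g0 F g| <= (gorder g)%:R.
Proof.
move=> F1; apply: le_trans (ler_norm_sum _ _ _) _.
apply: le_trans (ler_sum _ (fun u _ => F1 _ _)) _.
by rewrite sumr_const card_ord.
Qed.

End StatisticsCounts.

Lemma cvg_div_n_shift (R : realType) (N0 : nat) :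
  (N0 + n)%N%:R / n%:R @[n --> \oo] --> (1 : R).
Proof.
have L : N0%:R * n%:R^-1 + 1 @[n --> \oo] --> (N0%:R * 0 + 1 : R).
  apply: cvgD; last exact: cvg_cst.
  apply: cvgM; first exact: cvg_cst.
  apply/gtr0_cvgV0; last exact: cvgr_idn.
  by near=> n; rewrite ltr0n; near: n; exact: nbhs_infty_gt.
rewrite mulr0 add0r in L; apply: cvg_trans L; apply: near_eq_cvg; near=> n.
have n_gt0 : (0 : R) < n%:R by rewrite ltr0n; near: n; exact: nbhs_infty_gt.
by rewrite natrD mulrDl divff // lt0r_neq0.
Unshelve. all: by end_near. Qed.

Lemma p_infE (R : realType) (m : nat) (pi : 'I_m.+1 -> R) (kappa : 'M[R]_m.+1)
    (eta : 'I_m.+1 -> R) a k :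
  p_inf pi kappa eta a k = yule (2 / phi pi kappa eta a) k.
Proof. by case: k. Qed.

(** * The strong law for the statistics of the process *)

Section Trajectory.
Context {d : measure_display} {T : measurableType d} {R : realType}.
Variables (m : nat) (P : probability T R).
Variables (pi : 'I_m.+1 -> R) (kappa : 'M[R]_m.+1) (g0 : network m).
Variables (tau : nat -> T -> 'I_m.+1) (alpha : nat -> T -> nat).
Variable eta : 'I_m.+1 -> R.
Hypothesis hpi : is_pmf_on_types pi.
Hypothesis pi_gt0 : forall a, 0 < pi a.
Hypothesis kappa_gt0 : forall a b, 0 < kappa a b.
Hypothesis hg0 : is_tree g0.
Hypothesis hG : is_network_process P pi kappa g0 tau alpha.
Hypothesis heta : is_minimizer pi kappa eta.

Let wf := wf_network R g0.

Lemma wf_net n w : wf (net g0 tau alpha n w).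
Proof.
elim: n => [|n IHn]; first exact: wf_tree.
by apply: wf_attach => //; exact: (np_alpha_vertex hG).
Qed.

Lemma gorder_net n w : gorder (net g0 tau alpha n w) = (gorder g0 + n)%N.
Proof. by elim: n => [|n IHn]; rewrite ?addn0 //= gorder_attach IHn addnS. Qed.

Lemma size_nedges_net n w :
  size (nedges (net g0 tau alpha n w)) = (size (nedges g0) + n)%N.
Proof. by elim: n => [|n IHn]; rewrite ?addn0 //= size_rcons IHn addnS. Qed.

Lemma total_degree_net n w : total_degree R g0 (net g0 tau alpha n w) =
  total_degree R g0 g0 + 2 * n%:R :> R.
Proof.
elim: n => [|n IHn]; first by rewrite mulr0 addr0.
rewrite /= total_degree_attach ?IHn //; last exact: (np_alpha_vertex hG).
  by rewrite -(natr1 n); ring.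
exact: wf_net.
Qed.

(** The conclusion of the strong law on one trajectory; the theorem intersects countably many such
    events. *)
Definition balanced (f : network m -> R) (w : T) : Prop :=
  compensated pi kappa g0 f (fun i => net g0 tau alpha i w) n / n%:R
    @[n --> \oo] --> (0 : R).

Lemma ae_balanced (f : network m -> R) :
  (forall g v b, wf g -> (v < gorder g)%N -> `|f (attach g v b) - f g| <= 2) ->
  {ae P, forall w, balanced f w}.
Proof.
move=> f_lip; apply: (network_slln hpi hG (inv := wf) (c := 2)) => //.
- exact: wf_tree.
- by move=> g v b; exact: wf_attach.
- by move=> g b v; exact: attach_prob_ge0.
- by move=> g b; exact: sum_attach_prob.
Qed.

Lemma ae_balanced_stat (F : 'I_m.+1 -> nat -> R) :
  (forall t, `|F t 1%N| <= 1) -> (forall t j, `|F t j.+1 - F t j| <= 1) ->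
  {ae P, forall w, balanced (stat g0 F) w}.
Proof.
move=> F1 dF; apply: ae_balanced => g v b wg vg; rewrite stat_attach //.
by apply: le_trans (ler_normD _ _) _; have := lerD (F1 b) (dF (vtype g v) (deg g0 g v)).
Qed.

Lemma ae_balanced_type_degree a : {ae P, forall w, balanced (type_degree R g0 a) w}.
Proof.
apply: ae_balanced_stat => [t|t j]; first by rewrite mulr1; case: eqP; rewrite ?normr1 ?normr0.
rewrite -(natr1 j) mulrDr addrC addKr mulr1.
by case: eqP; rewrite ?normr1 ?normr0.
Qed.

Lemma ae_balanced_type_count a : {ae P, forall w, balanced (type_count R g0 a) w}.
Proof.
apply: ae_balanced_stat => [t|t j]; last by rewrite subrr normr0.
by case: eqP; rewrite ?normr1 ?normr0.
Qed.

Lemma ae_balanced_degree_count a k :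
  {ae P, forall w, balanced (degree_count R g0 a k) w}.
Proof.
apply: ae_balanced_stat => [t|t j].
  by case: eqP; case: eqP; rewrite ?mulr1 ?mulr0 ?normr1 ?normr0.
rewrite -mulrBr normrM.
have [_|_] := eqVneq t a; last by rewrite normr0 mul0r.
rewrite normr1 mul1r; have [<-|_] := eqVneq j.+1 k.
  by rewrite ltn_eqF // subr0 normr1.
by rewrite sub0r normrN; case: eqP; rewrite ?normr1 ?normr0.
Qed.

Lemma ae_balanced_edge_count a a' :
  {ae P, forall w, balanced (edge_count R a a') w}.
Proof.
apply: ae_balanced => g v b wg vg; rewrite (edge_count_attach _ _ _ wg vg).
by case: (_ || _); rewrite ?normr1 ?normr0 ?ler1n.
Qed.

(** * Deterministic limits along one trajectory *)

Section Path.
Variable w : T.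
Let G n := net g0 tau alpha n w.
Let s0 : R := total_degree R g0 g0.
Let x n a := type_degree R g0 a (G n) / (s0 + 2 * n%:R).

Let s0_gt0 : 0 < s0.
Proof. by have [] := wf_tree R hg0. Qed.

Let S_gt0 n : 0 < s0 + 2 * n%:R.
Proof. by rewrite ltr_wpDr // mulr_ge0. Qed.

Hypothesis type_degree_balanced : forall a, balanced (type_degree R g0 a) w.

Lemma cvg_type_degree a : x n a @[n --> \oo] --> eta a.
Proof.
apply: (cvg_share (X := fun n a => type_degree R g0 a (G n)) hpi pi_gt0 kappa_gt0 heta s0_gt0).
- by move=> n b; exact: type_degree_ge0.
- by move=> n; rewrite sum_type_degree total_degree_net.
- move=> b; have := type_degree_balanced b; rewrite /balanced /compensated /=.
  apply: cvg_trans; apply: near_eq_cvg; near=> n.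
  congr (_ / _); congr (_ - _); apply: eq_bigr => i _.
  rewrite drift_type_degree //; last exact: wf_net.
  congr (_ + _); rewrite /flow /attach_rate mulr_suml; apply: eq_bigr => c _.
  by rewrite attractivityE mulrAC mulrA.
Unshelve. all: by end_near. Qed.

Let attractivity_x n b : attractivity kappa g0 b (G n) =
  (s0 + 2 * n%:R) * attract kappa (x n) b.
Proof.
rewrite attractivityE /attract mulr_sumr; apply: eq_bigr => l _.
by rewrite /x mulrCA [_ * (_ / _)]mulrC divfK // gt_eqF.
Qed.

Let cvg_attract b : attract kappa (x n) b @[n --> \oo] --> attract kappa eta b.
Proof.
apply: cvg_fin_sum => l; apply: cvgM; first exact: cvg_cst.
exact: cvg_type_degree.
Qed.

(** The total degree grows like [2 n], which produces the factor [1 / 2]. *)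
Lemma cvg_attach_rate a : n%:R * attach_rate pi kappa g0 a (G n) @[n --> \oo]
  --> phi pi kappa eta a / 2.
Proof.
have -> : (fun n => n%:R * attach_rate pi kappa g0 a (G n)) =
    (fun n => (\sum_b pi b * kappa a b / attract kappa (x n) b) *
      (n%:R / (s0 + 2 * n%:R))).
  apply/funext => n; rewrite /attach_rate mulr_sumr mulr_suml; apply: eq_bigr => b _.
  by rewrite attractivity_x invfM; ring.
apply: cvgM; last exact: cvg_n_affine.
have -> : phi pi kappa eta a = \sum_b pi b * kappa a b / attract kappa eta b.
  by apply: eq_bigr => b _; rewrite /phi2 /nu /attract; ring.
apply: cvg_fin_sum => b; apply: cvgM; first exact: cvg_cst.
apply: cvgV; last exact: cvg_attract.
by rewrite gt_eqF // (attract_minimizer_gt0 kappa_gt0 heta).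
Qed.

Lemma cvg_edge_share a b : type_degree R g0 a (G n) / attractivity kappa g0 b (G n)
  @[n --> \oo] --> eta a / attract kappa eta b.
Proof.
have -> : (fun n => type_degree R g0 a (G n) / attractivity kappa g0 b (G n)) =
    (fun n => x n a / attract kappa (x n) b).
  by apply/funext => n; rewrite attractivity_x invfM mulrA.
apply: cvgM; first exact: cvg_type_degree.
apply: cvgV; last exact: cvg_attract.
by rewrite gt_eqF // (attract_minimizer_gt0 kappa_gt0 heta).
Qed.

(** [N0 + n] stands for the number of vertices or of edges, which bounds every count; the initial
    value [f g0] disappears after division by [n]. *)
Lemma cvg_balanced_affine (f : network m -> R) (N0 : nat) (b c : nat -> R)
    (beta gamma : R) :
  0 <= gamma -> balanced f w ->
  (forall n, `|f (G n)| <= (N0 + n)%N%:R) ->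
  (\forall n \near \oo,
     drift pi kappa g0 f (G n) = b n - c n * (f (G n) / n%:R)) ->
  b n @[n --> \oo] --> beta -> c n @[n --> \oo] --> gamma ->
  f (G n) / n%:R @[n --> \oo] --> beta / (1 + gamma).
Proof.
move=> gamma_ge0 f_bal f_bnd f_drift cb cc.
apply: (cvg_drift_average (F := fun n => f (G n)) (K := N0%:R + 1)
  gamma_ge0 f_drift _ cb cc).
- near=> n.
  have n_gt0 : (0 : R) < n%:R by rewrite ltr0n; near: n; exact: nbhs_infty_gt.
  have n_ge1 : (1 : R) <= n%:R by rewrite ler1n -(ltr0n R).
  rewrite normrM [`|n%:R^-1|]gtr0_norm ?invr_gt0 // ler_pdivrMr //.
  apply: le_trans (f_bnd n) _; rewrite natrD mulrDl mul1r lerD2r.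
  by rewrite ler_peMr.
- have L : compensated pi kappa g0 f (fun i => net g0 tau alpha i w) n / n%:R +
      f g0 * n%:R^-1 @[n --> \oo] --> (0 + f g0 * 0 : R).
    apply: cvgD; first exact: f_bal.
    apply: cvgM; first exact: cvg_cst.
    apply/gtr0_cvgV0; last exact: cvgr_idn.
    by near=> n; rewrite ltr0n; near: n; exact: nbhs_infty_gt.
  rewrite mulr0 addr0 in L; apply: cvg_trans L; apply: near_eq_cvg; near=> n.
  by rewrite /compensated -mulrDl /=; congr (_ / _); rewrite -/(G n); ring.
Unshelve. all: by end_near. Qed.

Lemma cvg_balanced (f : network m -> R) (N0 : nat) (l : R) :
  balanced f w -> (forall n, `|f (G n)| <= (N0 + n)%N%:R) ->
  drift pi kappa g0 f (G n) @[n --> \oo] --> l ->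
  f (G n) / n%:R @[n --> \oo] --> l.
Proof.
move=> f_bal f_bnd f_drift.
have -> : l = l / (1 + 0) by rewrite addr0 divr1.
apply: (cvg_balanced_affine (c := fun=> 0) (lexx 0) f_bal f_bnd _ f_drift).
  by near=> n; rewrite mul0r subr0.
exact: cvg_cst.
Unshelve. all: by end_near. Qed.

Lemma cvg_type_count a : balanced (type_count R g0 a) w ->
  type_count R g0 a (G n) / n%:R @[n --> \oo] --> pi a.
Proof.
move=> bal; apply: (cvg_balanced (N0 := gorder g0) bal).
  move=> n; rewrite -(gorder_net n w); apply: stat_norm_le => t j.
  by case: (t == a); rewrite ?normr1 ?normr0.
have -> : (fun n => drift pi kappa g0 (type_count R g0 a) (G n)) = fun=> pi a.
  by apply/funext => n; rewrite drift_type_count //; exact: wf_net.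
exact: cvg_cst.
Qed.

(** Induction on the degree: vertices of degree [k - 1] feed the inhomogeneous term, whose limit is
    already known, and the loss coefficient tends to [k / s]. *)
Lemma cvg_degree_count a k : (forall k, balanced (degree_count R g0 a k) w) ->
  degree_count R g0 a k (G n) / n%:R @[n --> \oo] --> pi a * p_inf pi kappa eta a k.
Proof.
move=> bal.
pose s := 2 / phi pi kappa eta a.
have s_gt0 : 0 < s by rewrite divr_gt0 // (phi_gt0 kappa_gt0 heta).
have phiE : phi pi kappa eta a / 2 = s^-1 by rewrite /s invf_div.
have step j (l : R) :
    j.-1%:R * (degree_count R g0 a j.-1 (G n) / n%:R) @[n --> \oo] --> l ->
    degree_count R g0 a j (G n) / n%:R @[n --> \oo] -->
    (pi a * (j == 1%N)%:R + s^-1 * l) / (1 + s^-1 * j%:R).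
  move=> cl.
  apply: (cvg_balanced_affine (N0 := gorder g0)
    (b := fun n => pi a * (j == 1%N)%:R + (n%:R * attach_rate pi kappa g0 a (G n)) *
       (j.-1%:R * (degree_count R g0 a j.-1 (G n) / n%:R)))
    (c := fun n => n%:R * attach_rate pi kappa g0 a (G n) * j%:R)) => //.
  - by rewrite mulr_ge0 // invr_ge0 ltW.
  - move=> n; rewrite -(gorder_net n w); apply: stat_norm_le => t i.
    by case: (t == a); case: (i == j); rewrite ?mulr1 ?mulr0 ?normr1 ?normr0.
  - near=> n; rewrite drift_degree_count //; last exact: wf_net.
    have n_gt0 : (0 : R) < n%:R by rewrite ltr0n; near: n; exact: nbhs_infty_gt.
    by field; rewrite lt0r_neq0.
  - apply: cvgD; first exact: cvg_cst.
    by rewrite -phiE; apply: cvgM; [exact: cvg_attach_rate|exact: cl].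
  - by rewrite -phiE; apply: cvgM; [exact: cvg_attach_rate|exact: cvg_cst].
elim: k => [|k IHk].
  have := step 0%N 0; rewrite !mulr0 addr0 mul0r; apply.
  by under eq_fun do rewrite mul0r; exact: cvg_cst.
have L : k%:R * (degree_count R g0 a k (G n) / n%:R) @[n --> \oo] -->
    (k%:R * (pi a * p_inf pi kappa eta a k) : R).
  by apply: cvgM; [exact: cvg_cst|exact: IHk].
have := step k.+1 _ L; rewrite !p_infE -/s eqSS.
have k_ge0 : 0 < 1 + s^-1 * k.+1%:R by rewrite addr_gt0 // mulr_gt0 // invr_gt0.
rewrite (_ : (_ + _) / _ = pi a * yule s k.+1) //.
apply: (mulIf (lt0r_neq0 k_ge0)); rewrite divfK ?lt0r_neq0 //.
have := yule_rec s_gt0 k; rewrite [k.+1%:R / s]mulrC => h.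
by rewrite -mulrA h; ring.
Unshelve. all: by end_near. Qed.

Hypothesis type_count_balanced : forall a, balanced (type_count R g0 a) w.
Hypothesis edge_count_balanced : forall a a', balanced (edge_count R a a') w.
Hypothesis degree_count_balanced : forall a k, balanced (degree_count R g0 a k) w.

Lemma cvg_emp_deg a k :
  emp_deg R g0 (G n) a k @[n --> \oo] --> p_inf pi kappa eta a k.
Proof.
have L : (degree_count R g0 a k (G n) / n%:R) * (type_count R g0 a (G n) / n%:R)^-1
    @[n --> \oo] --> (pi a * p_inf pi kappa eta a k) * (pi a)^-1.
  apply: cvgM; first exact: cvg_degree_count.
  apply: cvgV; first by rewrite gt_eqF.
  exact: cvg_type_count.
rewrite mulrAC divff ?mul1r ?gt_eqF // in L.
apply: cvg_trans L; apply: near_eq_cvg; near=> n.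
have n_gt0 : (0 : R) < n%:R by rewrite ltr0n; near: n; exact: nbhs_infty_gt.
by rewrite emp_degE invf_div mulrA divfK // gt_eqF.
Unshelve. all: by end_near. Qed.

(** Limiting probability that a new vertex has type [a'] and its parent type [a]. *)
Let edge_limit a a' : R := phi2 pi kappa eta a a' * eta a.

Lemma edge_count_norm_le a a' n :
  `|edge_count R a a' (G n)| <= (size (nedges g0) + n)%N%:R.
Proof.
rewrite ger0_norm // /edge_count ler_nat -(size_nedges_net n w).
exact: count_size.
Qed.

Lemma cvg_edge_count_diag a :
  edge_count R a a (G n) / n%:R @[n --> \oo] --> edge_limit a a.
Proof.
apply: (cvg_balanced (N0 := size (nedges g0))) => //.
  exact: edge_count_norm_le.
have -> : edge_limit a a = pi a * kappa a a * (eta a / attract kappa eta a).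
  by rewrite /edge_limit /phi2 /nu /attract; ring.
have -> : (fun n => drift pi kappa g0 (edge_count R a a) (G n)) =
    fun n => pi a * kappa a a *
      (type_degree R g0 a (G n) / attractivity kappa g0 a (G n)).
  by apply/funext => n; rewrite (drift_edge_count_diag _ _ _ (wf_net n w)).
by apply: cvgM; [exact: cvg_cst|exact: cvg_edge_share].
Qed.

Lemma cvg_edge_count a a' : a != a' ->
  edge_count R a a' (G n) / n%:R @[n --> \oo] --> edge_limit a a' + edge_limit a' a.
Proof.
move=> aa'; apply: (cvg_balanced (N0 := size (nedges g0))) => //.
  exact: edge_count_norm_le.
have -> : edge_limit a a' + edge_limit a' a =
    pi a' * kappa a a' * (eta a / attract kappa eta a') +
    pi a * kappa a' a * (eta a' / attract kappa eta a).
  by rewrite /edge_limit /phi2 /nu /attract; ring.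
have -> : (fun n => drift pi kappa g0 (edge_count R a a') (G n)) =
    fun n => pi a' * kappa a a' *
      (type_degree R g0 a (G n) / attractivity kappa g0 a' (G n)) +
      pi a * kappa a' a *
      (type_degree R g0 a' (G n) / attractivity kappa g0 a (G n)).
  by apply/funext => n; rewrite (drift_edge_count _ _ (wf_net n w)).
by apply: cvgD; (apply: cvgM; [exact: cvg_cst|exact: cvg_edge_share]).
Qed.

(** The first-order condition turns the denominator [2 - phi a] into [pi a / eta a]. *)
Lemma MmxE a b : Mmx pi kappa eta a b = edge_limit a b / pi a.
Proof.
have [[eta_gt0 _] _] := heta.
have := first_order_condition hpi kappa_gt0 heta a.
rewrite mxE /edge_limit => h.
have -> : 2 - phi pi kappa eta a = pi a / eta a by move: h; lra.
by field; rewrite !lt0r_neq0.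
Qed.

Let V a n : R := type_count R g0 a (G n).
Let N n : R := (gorder (G n))%:R.
Let E n : R := (size (nedges (G n)))%:R.

Let cvg_inv_n : n%:R^-1 @[n --> \oo] --> (0 : R).
Proof.
apply/gtr0_cvgV0; last exact: cvgr_idn.
by near=> n; rewrite ltr0n; near: n; exact: nbhs_infty_gt.
Unshelve. all: by end_near. Qed.

Let cvg_N : N n / n%:R @[n --> \oo] --> (1 : R).
Proof.
have -> : (fun n => N n / n%:R) = fun n => (gorder g0 + n)%N%:R / n%:R.
  by apply/funext => n; rewrite /N gorder_net.
exact: cvg_div_n_shift.
Qed.

Let cvg_E : E n / n%:R @[n --> \oo] --> (1 : R).
Proof.
have -> : (fun n => E n / n%:R) = fun n => (size (nedges g0) + n)%N%:R / n%:R.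
  by apply/funext => n; rewrite /E size_nedges_net.
exact: cvg_div_n_shift.
Qed.

Let cvg_pred (F : nat -> R) (l : R) : F n / n%:R @[n --> \oo] --> l ->
  (F n - 1) / n%:R @[n --> \oo] --> l.
Proof.
move=> cF; rewrite -[X in _ --> X]subr0.
under eq_fun do rewrite mulrBl mul1r.
by apply: cvgB; [exact: cF|exact: cvg_inv_n].
Qed.

Let near_pos (F : nat -> R) (l : R) : 0 < l -> F n / n%:R @[n --> \oo] --> l ->
  \forall n \near \oo, 0 < F n.
Proof.
move=> l_gt0 cF; near=> n.
have n_gt0 : (0 : R) < n%:R by rewrite ltr0n; near: n; exact: nbhs_infty_gt.
rewrite -(pmulr_lgt0 _ (_ : 0 < n%:R^-1)) ?invr_gt0 //; near: n.
exact: cvgr_gt cF _ l_gt0.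
Unshelve. all: by end_near. Qed.

Lemma cvg_homD a : homD R (G n) a @[n --> \oo] --> Mmx pi kappa eta a a / pi a.
Proof.
have pa := pi_gt0 a.
have cV := cvg_type_count (type_count_balanced a).
have cV1 := cvg_pred cV; have cN1 := cvg_pred cvg_N.
(* The factors [1 / 2] of the two binomial coefficients cancel. *)
have L : (edge_count R a a (G n) / n%:R) * ((N n / n%:R) * ((N n - 1) / n%:R)) *
    ((V a n / n%:R) * ((V a n - 1) / n%:R) * (E n / n%:R))^-1 @[n --> \oo] -->
    edge_limit a a * (1 * 1) * (pi a * pi a * 1)^-1.
  apply: cvgM.
    by apply: cvgM; [exact: cvg_edge_count_diag|apply: cvgM].
  apply: cvgV; first by rewrite gt_eqF // !mulr_gt0.
  by do 2?apply: cvgM.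
have -> : Mmx pi kappa eta a a / pi a = edge_limit a a * (1 * 1) * (pi a * pi a * 1)^-1.
  by rewrite MmxE !mulr1 invfM mulrA.
apply: cvg_trans L; apply: near_eq_cvg; near=> n.
have n_gt0 : (0 : R) < n%:R by rewrite ltr0n; near: n; exact: nbhs_infty_gt.
have V_gt0 : 0 < V a n by near: n; exact: near_pos cV.
have V1_gt0 : 0 < V a n - 1 by near: n; exact: near_pos cV1.
have N_gt0 : 0 < N n by near: n; exact: near_pos cvg_N.
have N1_gt0 : 0 < N n - 1 by near: n; exact: near_pos cN1.
have E_gt0 : 0 < E n by near: n; exact: near_pos cvg_E.
rewrite /homD /edge_density !bin2R (nvertE R g0) -/(V a n) -/(N n) -/(E n).
rewrite -/(edge_count R a a (G n)).
by field; rewrite !lt0r_neq0.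
Unshelve. all: by end_near. Qed.

Lemma cvg_homH a a' : a' != a -> homH R (G n) a a' @[n --> \oo] -->
  2^-1 * (Mmx pi kappa eta a' a / pi a + Mmx pi kappa eta a a' / pi a').
Proof.
move=> aa'; have pa := pi_gt0 a; have pa' := pi_gt0 a'.
have cV := cvg_type_count (type_count_balanced a).
have cV' := cvg_type_count (type_count_balanced a').
have cN1 := cvg_pred cvg_N.
(* Only the edge density has a binomial coefficient here, so its [1 / 2] survives. *)
have L : 2^-1 * (edge_count R a a' (G n) / n%:R) * ((N n / n%:R) * ((N n - 1) / n%:R)) *
    ((V a n / n%:R) * (V a' n / n%:R) * (E n / n%:R))^-1 @[n --> \oo] -->
    2^-1 * (edge_limit a a' + edge_limit a' a) * (1 * 1) * (pi a * pi a' * 1)^-1.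
  apply: cvgM.
    apply: cvgM; last by apply: cvgM.
    by apply: cvgM; [exact: cvg_cst|apply: cvg_edge_count; rewrite eq_sym].
  apply: cvgV; first by rewrite gt_eqF // !mulr_gt0.
  by do 2?apply: cvgM.
have -> : 2^-1 * (Mmx pi kappa eta a' a / pi a + Mmx pi kappa eta a a' / pi a') =
    2^-1 * (edge_limit a a' + edge_limit a' a) * (1 * 1) * (pi a * pi a' * 1)^-1.
  by rewrite !MmxE; field; rewrite !lt0r_neq0.
apply: cvg_trans L; apply: near_eq_cvg; near=> n.
have n_gt0 : (0 : R) < n%:R by rewrite ltr0n; near: n; exact: nbhs_infty_gt.
have V_gt0 : 0 < V a n by near: n; exact: near_pos cV.
have V'_gt0 : 0 < V a' n by near: n; exact: near_pos cV'.
have N_gt0 : 0 < N n by near: n; exact: near_pos cvg_N.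
have N1_gt0 : 0 < N n - 1 by near: n; exact: near_pos cN1.
have E_gt0 : 0 < E n by near: n; exact: near_pos cvg_E.
rewrite /homH /edge_density !bin2R !(nvertE R g0) -/(V a n) -/(V a' n) -/(N n) -/(E n).
rewrite -/(edge_count R a a' (G n)).
by field; rewrite !lt0r_neq0.
Unshelve. all: by end_near. Qed.

End Path.
End Trajectory.

Theorem theorem3p8 (R : realType) (d : measure_display) (T : measurableType d)
  (P : probability T R) (m : nat)
  (pi : 'I_m.+1 -> R) (kappa : 'M[R]_m.+1)
  (g0 : network m) (tau : nat -> T -> 'I_m.+1) (alpha : nat -> T -> nat)
  (eta : 'I_m.+1 -> R)
  (hpi : is_pmf_on_types pi)
  (pi_gt0 : forall a, 0 < pi a)
  (kappa_gt0 : forall a b, 0 < kappa a b)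
  (hg0 : is_tree g0)
  (hG : is_network_process P pi kappa g0 tau alpha)
  (heta : is_minimizer pi kappa eta) :
  (forall a : 'I_m.+1,
     [/\ is_pmf (p_inf pi kappa eta a),
         {ae P, forall w, forall k : nat,
            emp_deg R g0 (net g0 tau alpha n w) a k @[n --> \oo]
              --> p_inf pi kappa eta a k} &
         exists2 c : R, 0 < c &
           p_inf pi kappa eta a ~_\oo
             (fun k : nat => c * k%:R `^ (- (1 + 2 / phi pi kappa eta a)))])
  /\
  {ae P, forall w, forall a : 'I_m.+1,
     (homD R (net g0 tau alpha n w) a @[n --> \oo]
        --> Mmx pi kappa eta a a / pi a)
     /\
     (forall a' : 'I_m.+1, a' != a ->
        homH R (net g0 tau alpha n w) a a' @[n --> \oo]
          --> 2^-1 * (Mmx pi kappa eta a' a / pi a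
                      + Mmx pi kappa eta a a' / pi a'))}.
Proof.
pose bal := balanced pi kappa g0 tau alpha.
have bal_deg : {ae P, forall w, forall a, bal (type_degree R g0 a) w}.
  by apply: filter_forall => a; exact: ae_balanced_type_degree.
have bal_type : {ae P, forall w, forall a, bal (type_count R g0 a) w}.
  by apply: filter_forall => a; exact: ae_balanced_type_count.
have bal_count : {ae P, forall w, forall a k, bal (degree_count R g0 a k) w}.
  (* The types are finite in number, the degrees countable. *)
  apply: filter_forall => a; apply: ae_foralln => k.
  exact: ae_balanced_degree_count.
have bal_edge : {ae P, forall w, forall a a', bal (edge_count R a a') w}.
  apply: filter_forall => a; apply: filter_forall => a'.
  exact: ae_balanced_edge_count.
split=> [a|].
  have s_gt0 : 0 < 2 / phi pi kappa eta a.
    by rewrite divr_gt0 // (phi_gt0 kappa_gt0 heta).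
  have pE : p_inf pi kappa eta a = yule (2 / phi pi kappa eta a).
    by apply/funext => k; exact: p_infE.
  split; [by rewrite pE; exact: yule_is_pmf| |by rewrite pE; exact: yule_tail].
  apply: filterS3 bal_deg bal_type bal_count => w h1 h2 h3 k.
  exact: (cvg_emp_deg hpi pi_gt0 kappa_gt0 hg0 hG heta h1 h2 h3).
apply: filterS3 bal_deg bal_type bal_edge => w h1 h2 h3 a; split.
  exact: (cvg_homD hpi pi_gt0 kappa_gt0 hg0 hG heta h1 h2 h3).
by move=> a'; exact: (cvg_homH hpi pi_gt0 kappa_gt0 hg0 hG heta h1 h2 h3).
Qed.
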